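(* Let $f\colon\mathbb{C}\to\mathbb{C}$, $f(z)=e^z$ (the case $\lambda=1$ of the family $f_\lambda(z)=\lambda e^z$). For any itinerary $\mathbf{c}=c_0c_1c_2\ldots$ (sequence of integers), the set $\Lambda_{\mathbf{c}}$ of all points with itinerary $\mathbf{c}$ satisfies $$\dim_H(\Lambda_{\mathbf{c}})\leqslant 1.$$
   Context: $\mathbb{N}=\{0,1,2,\ldots\}$. For $k\in\mathbb{Z}$ let $P_k=\{z\in\mathbb{C}:(2k-1)\pi<\operatorname{Im}(z)\leqslant(2k+1)\pi\}$. The itinerary of $z\in\mathbb{C}$ is the sequence of integers $\mathbf{c}=c_0c_1c_2\ldots$ such that $f^n(z)\in P_{c_n}$ for every $n\in\mathbb{N}$, where $f^n$ is the $n$-th iterate of $f$. For a sequence of integers $\mathbf{c}$, $\Lambda_{\mathbf{c}}=\{z\in\mathbb{C}: f^n(z)\in P_{c_n}\text{ for all }n\in\mathbb{N}\}$. $\dim_H$ denotes Hausdorff dimension. *)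

(* Defs.v *)
From HB Require Import structures.
From mathcomp Require Import all_boot all_order all_algebra.
From mathcomp Require Import all_classical all_reals all_analysis.
From mathcomp.real_closed Require Import complex.

Set Implicit Arguments.
Unset Strict Implicit.
Unset Printing Implicit Defensive.

Import Order.TTheory GRing.Theory Num.Theory.
Import numFieldNormedType.Exports.

Local Open Scope classical_set_scope.
Local Open Scope ring_scope.

(* The point 0 is added so that the diameter of the empty set is 0, not -oo. *)
Definition diameter (R : realType) (A : set R[i]) : \bar R :=
  ereal_sup
    ([set 0%E] `|` [set (Normc.normc (p.1 - p.2))%:E | p in A `*` A]).

(* (diam A)^s, where a nonempty set of diameter 0 has weight 1 for s = 0
   and the empty set has weight 0 for every s. *)
Definition diam_pow (R : realType) (s : R) (A : set R[i]) : \bar R :=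
  if A == set0 then 0%E else poweR (diameter A) s.

Definition hausdorff_premeasure (R : realType) (s delta : R) (A : set R[i]) :
    \bar R :=
  ereal_inf [set (\sum_(0 <= j <oo) diam_pow s (U j))%E |
    U in [set U : nat -> set R[i] |
      A `<=` \bigcup_j U j /\ forall j, (diameter (U j) <= delta%:E)%E]].

(* The supremum over delta > 0 is the limit as delta tends to 0, since
   hausdorff_premeasure s delta A is nonincreasing in delta. *)
Definition hausdorff_measure (R : realType) (s : R) (A : set R[i]) : \bar R :=
  ereal_sup [set hausdorff_premeasure s delta A | delta in [set d : R | 0 < d]].

Definition hausdorff_dim (R : realType) (A : set R[i]) : \bar R :=
  ereal_inf
    [set s%:E | s in [set s : R | 0 <= s /\ hausdorff_measure s A = 0%E]].

(* e^(x + iy) = e^x (cos y + i sin y) *)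
Definition expC (R : realType) (z : R[i]) : R[i] :=
  Complex (expR (complex.Re z) * cos (complex.Im z))
          (expR (complex.Re z) * sin (complex.Im z)).

Definition strip (R : realType) (k : int) : set R[i] :=
  [set z | (2 * k%:~R - 1) * pi < complex.Im z <= (2 * k%:~R + 1) * pi].

Definition itinerary_set (R : realType) (f : R[i] -> R[i]) (c : nat -> int) :
    set R[i] :=
  [set z | forall n : nat, strip (c n) (iter n f z)].

(* Main.v *)
Require Import Defs.
From mathcomp Require Import all_boot all_order all_algebra.
From mathcomp Require Import all_classical all_reals all_analysis.
From mathcomp.real_closed Require Import complex.
From mathcomp Require Import ring lra zify.

Set Implicit Arguments.
Unset Strict Implicit.
Unset Printing Implicit Defensive.

Import Order.TTheory GRing.Theory Num.Theory.
Import numFieldNormedType.Exports.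

Local Open Scope classical_set_scope.
Local Open Scope ring_scope.

(** Fix [s > 1]. It suffices to show that the itinerary set is null, that is,
that it has covers with arbitrarily small sum of [diam ^ s]
([null_hausdorff_measure], [hausdorff_dim_le1]).

Reduction to half-strips. Cut the plane along the lines [Im z = k pi]. The
points of the itinerary set that eventually land on the real axis form a
countable union of pull-backs of pieces of a line, hence a null set
([null_real_axis], [null_iter]). If two of the remaining points have, at some
time, imaginary parts of opposite signs, then the symbol at that time is 0 and
the signs stay opposite forever ([opposite_persist]); so these points split
into two classes inside of which any two points visit the same half-strips at
all times. What remains is to compare two orbits of this kind.

Expansion. In a half-plane with the metric [|dz| / |Im z|], the map [exp]
expands by [|y| / |sin y| >= 1], where [y = Im z]. The two-point version is that
[|z - w| ^ 2 / (Im z * Im w)] is multiplied at each step by at least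
[gain |Im z|] ([expC_pair_gain]). The gain is bounded away from 1 when
[|y| >= 1/2] (a wide time), but it degenerates near the real axis. There an orbit
behaves as under real iteration: it moves to the right at exponential speed, and
each step multiplies [|y|] by at least the next real part; so a narrow run, of [m]
steps with [|y| < 1/2], requires a height that is initially smaller than
[exp (- (3/2) ^ m)], up to constants. Such a small height has to be created by the
one or two previous steps, and they pay for it with a gain of order [(3/2) ^ m]
([narrow_run_gain]). Consequently the product of the gains up to a wide time
grows exponentially in the number of steps ([gain_growth]).

Covering. Call a time good if [|y| >= 1/2] and [x >= -1]; every orbit has
infinitely many good times ([good_infinitely_often]). For a good time [i], sort
the points by the real part of the next iterate [z']: there are about [2 ^ p]
unit slices with [|Re z'| ~ 2 ^ p]. The step from [z'] back to time [i]
contracts by [|z'| >= 2 ^ p], up to a constant, and the [i] steps before it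
contract by [theta ^ i] with [theta < 1], so a slice has diameter
[O (theta ^ i * 2 ^ (-p))] ([slice_sqdist]). The sum over [i] and [p] of
[2 ^ p * (theta ^ i * 2 ^ (-p)) ^ s] converges because [s > 1], and its tails
[i >= N] bound the content of the whole set ([null_of_good_start]). *)

(** * The sine function and its quotient by the identity *)

Section sinc.
Variable R : realType.
Implicit Types x y a b : R.

Lemma ge0_is_derive_le (f df : R -> R) a b : a <= b ->
  (forall x, a <= x <= b -> is_derive x 1 f (df x)) ->
  (forall x, a <= x <= b -> 0 <= df x) -> f a <= f b.
Proof.
move=> ab fdf df0.
have fdf' x : x \in `]a, b[ -> is_derive x 1 f (df x).
  by rewrite in_itv/= => /andP[/ltW ? /ltW ?]; apply/fdf/andP.
have cf : {within `[a, b], continuous f}.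
  apply: derivable_within_continuous => x; rewrite in_itv/= => xab.
  by case: (fdf x xab).
have [c cab e] := MVT_segment ab fdf' cf.
rewrite -subr_ge0 e mulr_ge0 ?subr_ge0// df0//.
Qed.

Lemma sin_le_id x : 0 <= x -> sin x <= x.
Proof.
move=> x0; rewrite -subr_ge0.
have := @ge0_is_derive_le (fun x => x - sin x) (fun x => 1 - cos x) 0 x x0.
rewrite sin0 subr0; apply => y _; by rewrite subr_ge0 cos_le1.
Qed.

Lemma sqr_sin_le x : sin x ^+ 2 <= x ^+ 2.
Proof.
wlog x0 : x / 0 <= x => [hw|].
  have [/hw//|x0] := leP 0 x.
  by rewrite -sqrrN -sinN -[leRHS]sqrrN hw// oppr_ge0 ltW.
have [x1|x1] := leP x 1; last first.
  rewrite sin2cos2; apply: (@le_trans _ _ 1); last by nra.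
  by rewrite lerBlDr lerDl sqr_ge0.
have := sin_le_id x0; have : 0 <= sin x.
  by apply: sin_ge0_pi; rewrite x0 (le_trans x1)//; have := pi_ge2 R; lra.
by nra.
Qed.

Lemma cos_ge1B x : 1 - x ^+ 2 / 2 <= cos x.
Proof.
have -> : x = (x / 2) *+ 2 by rewrite -mulr_natr divfK.
rewrite cos_mulr2n cos2sin2; have := sqr_sin_le (x / 2).
rewrite (mulr2n (x / 2)) (mulr2n (1 - _)); move: (sin _ ^+ 2) => s.
have -> : (x / 2 + x / 2) ^+ 2 = 4 * (x / 2) ^+ 2 by field.
by move: ((x / 2) ^+ 2) => r; lra.
Qed.

Lemma xcos_le_sin x : 0 <= x <= pi -> x * cos x <= sin x.
Proof.
move=> /andP[x0 xpi]; rewrite -subr_ge0.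
have := @ge0_is_derive_le (fun x => sin x - x * cos x) (fun x => x * sin x) 0 x x0.
rewrite sin0 mul0r subrr; apply => y /andP[y0 yx]; last first.
  by rewrite mulr_ge0// sin_ge0_pi// y0 (le_trans yx).
apply: is_derive_eq.
by rewrite /GRing.scale /=; ring.
Qed.

(** Up to sign and a factor [x ^ 2] this is the derivative of [sin x / x]. For
[x <= 1] the cubic bound comes from differentiating once more; for [x >= 1] the
left-hand side is at most [4 ^ 3 / 500], while the right-hand side, which is
nondecreasing, is already at least [1 / 6] at 1. *)
Lemma sinBxcos_ge x : 0 <= x <= pi -> x ^+ 3 / 500 <= sin x - x * cos x.
Proof.
have key y : 0 <= y <= 1 -> y ^+ 3 / 6 <= sin y - y * cos y.
  move=> /andP[y0 y1]; rewrite -subr_ge0.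
  have := @ge0_is_derive_le (fun x => sin x - x * cos x - x ^+ 3 / 6)
     (fun x => x * sin x - x ^+ 2 / 2) 0 y y0.
  rewrite sin0 mul0r subrr expr0n/= mul0r subrr; apply => z /andP[z0 zy].
    apply: is_derive_eq.
    by rewrite /GRing.scale /=; field.
  have z1 : z <= 1 by lra.
  have z2 : z ^+ 2 <= 1 by rewrite expr_le1.
  have hc : 1 / 2 <= cos z by have := cos_ge1B z; lra.
  have hs : z * cos z <= sin z.
    by apply: xcos_le_sin; have := pi_ge2 R; lra.
  have hs2 : z / 2 <= sin z.
    apply: le_trans hs; rewrite -subr_ge0.
    have -> : z * cos z - z / 2 = z * (cos z - 1 / 2) by ring.
    by rewrite mulr_ge0// subr_ge0.
  have -> : z * sin z - z ^+ 2 / 2 = z * (sin z - z / 2) by ring.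
  by rewrite mulr_ge0// subr_ge0.
move=> /andP[x0 xpi]; have [x1|x1] := leP x 1.
  apply: le_trans (key x _); last by rewrite x0.
  by have := exprn_ge0 3 x0; lra.
have /key : 0 <= (1:R) <= 1 by rewrite ler01 lexx.
have : sin (1:R) - 1 * cos 1 <= sin x - x * cos x.
  apply: (@ge0_is_derive_le (fun x => sin x - x * cos x) (fun x => x * sin x)).
  - exact: ltW.
  - move=> y _; apply: is_derive_eq.
    by rewrite /GRing.scale /=; ring.
  - move=> y /andP[y0 yx].
    by rewrite mulr_ge0 ?sin_ge0_pi ?(le_trans _ y0)//= (le_trans yx).
have : x ^+ 3 <= 4 ^+ 3.
  by rewrite lerXn2r ?nnegrE//; have := pihalf_lt2 R; lra.
by rewrite !exprS !expr0; lra.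
Qed.

Lemma is_derive_opp_sinc k x : x != 0 ->
  is_derive x 1 (fun x => - (sin x / x + x ^+ 2 * k))
    ((sin x - x * cos x) / x ^+ 2 - x * k * 2).
Proof.
move=> x0.
have d2 : is_derive x 1 (fun y : R => y ^+ 2 * k) (x * k * 2).
  by apply: is_derive_eq; rewrite /GRing.scale /=; ring.
have dv : is_derive x 1 (fun y : R => y^-1) (- x ^- 2 *: 1) by exact: is_deriveV.
have d1 := @is_deriveM R R sin (fun y => y^-1) x 1 _ _ (is_derive_sin x) dv.
have := is_deriveN (is_deriveD d1 d2).
move=> [? e]; split; first by [].
rewrite e /GRing.scale /=.
by field.
Qed.

(** Locked, so that the numeral is never unfolded to a unary number. *)
Definition sinc_rate : R := locked (1 / 1000).

Lemma sinc_rate_bounds : 0 < sinc_rate <= 1 / 100.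
Proof. by rewrite /sinc_rate -lock; lra. Qed.

(** The two-point form of the strict expansion of the half-plane metric reduces to
a comparison of [sin x / x] at the half-difference and at the half-sum of two
heights; the quadratic term is what makes the expansion strict. *)
Lemma sinc_decr a b : 0 < a <= b -> b <= pi ->
  sin b / b + b ^+ 2 * sinc_rate <= sin a / a + a ^+ 2 * sinc_rate.
Proof.
move=> /andP[a0 ab] bpi; rewrite -lerN2.
have kE : 500^-1 = sinc_rate * 2 by rewrite /sinc_rate -lock; field.
have := sinBxcos_ge; rewrite kE => hge.
apply: (@ge0_is_derive_le (fun x => - (sin x / x + x ^+ 2 * sinc_rate))
  (fun x => (sin x - x * cos x) / x ^+ 2 - x * sinc_rate * 2) a b ab) => x /andP[ax xb].
- have x0 : x != 0 by rewrite gt_eqF// (lt_le_trans a0).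
  exact: is_derive_opp_sinc.
- have x0 : 0 < x by rewrite (lt_le_trans a0).
  rewrite subr_ge0 ler_pdivlMr ?exprn_gt0//.
  have -> : x * sinc_rate * 2 * x ^+ 2 = x ^+ 3 * (sinc_rate * 2) by ring.
  by apply: hge; rewrite (ltW x0) (le_trans xb).
Qed.

End sinc.

(** * Expansion of the exponential on pairs of points of a half-strip *)

Section pair_expansion.
Variable R : realType.
Implicit Types x y u v a b D : R.

(** With [b] the half-difference this is [b <= sinh b]. *)
Lemma expR_sqrB x1 x2 :
  expR (x1 + x2) * (x1 - x2) ^+ 2 <= (expR x1 - expR x2) ^+ 2.
Proof.
wlog x21 : x1 x2 / x2 <= x1 => [hw|].
  have [/hw//|/ltW/hw] := leP x2 x1.
  by rewrite addrC -sqrrN opprB -[leRHS]sqrrN opprB.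
pose b := (x1 - x2) / 2; have b0 : 0 <= b by rewrite /b; lra.
have hb : 0 <= expR b - expR (- b) - 2 * b.
  have := @ge0_is_derive_le R (fun x => expR x - expR (- x) - 2 * x)
    (fun x => expR x + expR (- x) - 2) 0 b b0.
  rewrite oppr0 expR0 subrr mulr0 subrr; apply => y _.
    by apply: is_derive_eq; rewrite /GRing.scale /=; ring.
  have e0 := expR_gt0 y; rewrite expRN.
  have -> : expR y + (expR y)^-1 - 2 = (expR y - 1) ^+ 2 / expR y by field; lra.
  by rewrite divr_ge0 ?sqr_ge0 ?ltW.
pose m := (x1 + x2) / 2.
have -> : x1 = m + b by rewrite /m /b; field.
have -> : x2 = m - b by rewrite /m /b; field.
rewrite !expRD.
have -> : m + b - (m - b) = 2 * b by ring.
have -> : expR m * expR b * (expR m * expR (- b)) * (2 * b) ^+ 2 =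
  (expR m * (2 * b)) ^+ 2 * (expR b * expR (- b)) by ring.
rewrite expRxMexpNx_1 mulr1 -mulrBr [leRHS]exprMn [leLHS]exprMn.
rewrite ler_wpM2l ?sqr_ge0//.
by rewrite lerXn2r ?nnegrE; lra.
Qed.

Lemma expC_sqr_dist x1 y1 x2 y2 :
  (expR x1 * cos y1 - expR x2 * cos y2) ^+ 2 +
  (expR x1 * sin y1 - expR x2 * sin y2) ^+ 2 =
  (expR x1 - expR x2) ^+ 2 + 4 * expR (x1 + x2) * sin ((y1 - y2) / 2) ^+ 2.
Proof.
have h : 4 * sin ((y1 - y2) / 2) ^+ 2 = 2 - 2 * cos (y1 - y2).
  have {2}-> : y1 - y2 = ((y1 - y2) / 2) *+ 2 by rewrite -mulr_natr divfK.
  by rewrite cos_mulr2n cos2sin2; ring.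
rewrite (mulrC 4) -mulrA h cosB expRD.
have := cos2Dsin2 y1; have := cos2Dsin2 y2.
move: (cos y1) (sin y1) (cos y2) (sin y2) => c1 s1 c2 s2 e2 e1.
transitivity (expR x1 ^+ 2 * (c1 ^+ 2 + s1 ^+ 2) + expR x2 ^+ 2 * (c2 ^+ 2 + s2 ^+ 2)
  - 2 * expR x1 * expR x2 * (c1 * c2 + s1 * s2)); first ring.
by rewrite e1 e2; ring.
Qed.

(** Jordan's inequality: the quotient is smallest at [pi / 2]. *)
Lemma sinc_ge D : 0 < D <= pi / 2 -> 2 <= pi * (sin D / D).
Proof.
move=> /andP[D0 Dpi]; have pi0 := @pi_gt0 R.
have := @sinc_decr R D (pi / 2); rewrite D0 Dpi sin_pihalf => /(_ erefl).
have h : D ^+ 2 * sinc_rate R <= (pi / 2) ^+ 2 * sinc_rate R.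
  have /andP[k0 _] := sinc_rate_bounds R.
  by rewrite (ler_pM2r k0) lerXn2r ?nnegrE; lra.
have hp : pi / 2 <= (pi : R) by lra.
move=> /(_ hp) {}hp.
have {hp}: 1 / (pi / 2) <= sin D / D by lra.
rewrite ler_pdivrMr ?divr_gt0//; lra.
Qed.

Lemma sinc_ge_half D : 0 < D <= pi / 2 -> 1 / 2 <= sin D / D.
Proof.
move=> /sinc_ge; have := @pihalf_lt2 R; have := @pi_gt0 R.
move: pi (_ / D) => q s q0 q4 qs; rewrite -subr_ge0 -(pmulr_rge0 _ q0); lra.
Qed.

Lemma sin_half_ge D : - (pi / 2) <= D <= pi / 2 -> D ^+ 2 / 4 <= sin D ^+ 2.
Proof.
wlog D0 : D / 0 <= D => [hw|].
  have [/hw//|D0 /andP[h1 h2]] := leP 0 D.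
  rewrite -sqrrN -[leRHS]sqrrN -sinN hw ?oppr_ge0 1?ltW//; lra.
move=> /andP[_ Dpi]; have [->|Dn0] := eqVneq D 0.
  by rewrite expr0n/= mul0r sqr_ge0.
have Dp : 0 < D by rewrite lt_neqAle eq_sym Dn0.
have := @sinc_ge_half D; rewrite Dp Dpi => /(_ erefl) h2.
have h3 : D / 2 <= sin D by move: h2; rewrite ler_pdivlMr//; lra.
have -> : D ^+ 2 / 4 = (D / 2) ^+ 2 by field.
by rewrite lerXn2r ?nnegrE//; lra.
Qed.

(** Derivative of size [expR x] at both points, and a loss of a factor 2 for the
passage from infinitesimal to finite distances in a strip of height [pi]. *)
Lemma expC_expand x1 y1 x2 y2 : `|y1 - y2| <= pi ->
  expR (x1 + x2) * ((x1 - x2) ^+ 2 + (y1 - y2) ^+ 2) <=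
  4 * ((expR x1 * cos y1 - expR x2 * cos y2) ^+ 2 +
  (expR x1 * sin y1 - expR x2 * sin y2) ^+ 2).
Proof.
rewrite ler_norml => /andP[h1 h2]; rewrite expC_sqr_dist.
have := expR_sqrB x1 x2; have := @sin_half_ge ((y1 - y2) / 2).
have e0 := expR_gt0 (x1 + x2).
have -> : - (pi / 2) <= (y1 - y2) / 2 <= pi / 2 by lra.
move=> /(_ erefl); set s := sin _ ^+ 2; set E := expR (x1 + x2) in e0 *.
have := sqr_ge0 (x1 - x2).
have -> : ((y1 - y2) / 2) ^+ 2 = (y1 - y2) ^+ 2 / 4 by field.
by nra.
Qed.

Definition gain_excess : R := sinc_rate R / 32.

(** Lower bound for the squared two-point expansion factor in the half-plane metric
at height [u]. The quarter of [u / |sin u|] is the part that becomes large; it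
allows for the loss of [(2 / pi) ^ 2] on points that are far apart. *)
Definition gain u : R :=
  if u < 1 / 2 then 1 else Num.max (1 + gain_excess) (u / `|sin u| / 4).

(** What is used of the fact that [y1] and [y2] lie between the same two consecutive
multiples of [pi]. *)
Definition same_half_strip (y1 y2 : R) := [/\ 0 < y1 * y2, 0 < sin y1 * sin y2,
  `|y1 - y2| <= pi & (`|y1| <= pi /\ `|y2| <= pi) \/ (pi <= `|y1| /\ pi <= `|y2|)].

Lemma sin_mul u v :
  sin u * sin v = sin ((u + v) / 2) ^+ 2 - sin ((u - v) / 2) ^+ 2.
Proof.
have -> : sin u = sin ((u + v) / 2 + (u - v) / 2) by congr sin; field.
have -> : sin v = sin ((u + v) / 2 - (u - v) / 2) by congr sin; field.
set a := (u + v) / 2; set b := (u - v) / 2.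
rewrite sinD sinB.
transitivity (sin a ^+ 2 * cos b ^+ 2 - cos a ^+ 2 * sin b ^+ 2); first ring.
by rewrite !cos2sin2; ring.
Qed.

Lemma gain_excess_bounds : 0 < gain_excess /\ gain_excess * 32 = sinc_rate R.
Proof. by rewrite /gain_excess; case/andP: (sinc_rate_bounds R) => k0 _; split; [rewrite divr_gt0|field]. Qed.

(** The gain for two points on the same horizontal line, where the half-difference
of the heights vanishes. *)
Lemma sqr_sin_le_excess u : 1 / 2 <= u <= pi -> (1 + gain_excess) * sin u ^+ 2 <= u ^+ 2.
Proof.
move=> /andP[u2 upi]; have u0 : 0 < u by lra.
have := @sinc_decr R (u / 2) u.
have -> : 0 < u / 2 <= u by lra.
move=> /(_ erefl upi) h.
have s0 : 0 <= sin u by rewrite sin_ge0_pi// (ltW u0).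
have : sin (u / 2) / (u / 2) <= 1.
  by rewrite ler_pdivrMr ?divr_gt0// mul1r sin_le_id//; lra.
have [e0 e1] := gain_excess_bounds; have /andP[k0 k1] := sinc_rate_bounds R.
have u2' : 1 / 4 <= u ^+ 2.
  have -> : 1 / 4 = (1 / 2) ^+ 2 :> R by field.
  by rewrite lerXn2r ?nnegrE//; lra.
have uE : (u / 2) ^+ 2 = u ^+ 2 / 4 by field.
rewrite uE in h; move=> h1; have {h1 h}: sin u / u <= 1 - gain_excess.
  by have := ler_wpM2r (ltW k0) u2'; lra.
rewrite ler_pdivrMr// => h.
have e2 : 0 <= 1 - gain_excess by lra.
have h2 : sin u ^+ 2 <= (1 - gain_excess) * u ^+ 2.
  have -> : (1 - gain_excess) * u ^+ 2 = ((1 - gain_excess) * u) * u by ring.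
  rewrite expr2 ler_pM// (le_trans h)// ler_piMl ?(ltW u0)//; lra.
apply: (@le_trans _ _ ((1 + gain_excess) * ((1 - gain_excess) * u ^+ 2))).
  by rewrite ler_wpM2l//; lra.
have -> : (1 + gain_excess) * ((1 - gain_excess) * u ^+ 2) = u ^+ 2 - gain_excess ^+ 2 * u ^+ 2 by ring.
by rewrite lerBlDr lerDl mulr_ge0 ?sqr_ge0.
Qed.

(** The algebra behind [vertical_gain]: [A] and [B] stand for [sin D / D] and
[sin S / S], with [D] and [S] the half-difference and the half-sum of the heights;
here [S] is the square of the half-sum, [P] the product of the heights and [s] the
product of their sines. *)
Lemma sinc_gap_algebra (A B S P s c k : R) : 0 <= B -> B + P * k <= A ->
  1 / 2 <= A -> 0 < P -> s = B ^+ 2 * S - A ^+ 2 * (S - P) -> s <= P ->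
  0 <= S -> 0 <= c -> 0 <= k -> c * 32 <= k -> c = 0 \/ 1 / 16 <= S ->
  (1 + c) * s <= A ^+ 2 * P.
Proof.
move=> B0 BA A2 P0 sE sP S0 c0 k0 ck hc.
have Pk0 : 0 <= P * k by rewrite mulr_ge0// ltW.
have AB : P * k * (1 / 2) <= A ^+ 2 - B ^+ 2.
  by rewrite subr_sqr ler_pM//; lra.
rewrite -subr_ge0.
have -> : A ^+ 2 * P - (1 + c) * s = S * (A ^+ 2 - B ^+ 2) - c * s.
  by rewrite mulrDl mul1r {1}sE; ring.
case: hc => [->|S4]; first by rewrite mul0r subr0 mulr_ge0//; lra.
have h1 : c * s <= c * P by rewrite ler_wpM2l.
have h2 : (1 / 16) * (P * k * (1 / 2)) <= S * (A ^+ 2 - B ^+ 2).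
  by rewrite ler_pM//; lra.
have h3 : c * 32 * P <= k * P by rewrite ler_wpM2r// ltW.
rewrite subr_ge0; lra.
Qed.

(** Write [y1 y2 = S ^ 2 - D ^ 2] and [sin y1 sin y2 = sin ^ 2 S - sin ^ 2 D]. Then the
comparison for a vertical displacement is that of [sin D / D] with [sin S / S]. The
factor [p] is the square of [sin D / D], and 1 if [D = 0]; since it is at most 1, the same bound holds
for horizontal displacements. *)
Lemma vertical_gain y1 y2 : same_half_strip y1 y2 -> exists p : R,
  [/\ 0 <= p <= 1, p * ((y1 - y2) / 2) ^+ 2 = sin ((y1 - y2) / 2) ^+ 2 &
  gain `|y1| * (sin y1 * sin y2) <= p * (y1 * y2)].
Proof.
wlog y10 : y1 y2 / 0 < y1 => [hw [ypos spos ypi hyp]|].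
  have [/hw|y10] := ltP 0 y1; first exact.
  have [||p [p0 pe pg]] := hw (- y1) (- y2).
  - by rewrite oppr_gt0 lt_neqAle y10 andbT; apply: contraTneq ypos => ->; rewrite mul0r ltxx.
  - by split; rewrite ?mulrNN ?sinN ?mulrNN ?normrN// -opprD normrN.
  exists p; split => //; last by move: pg; rewrite normrN !sinN !mulrNN.
  move: pe; have -> : (- y1 - - y2) / 2 = - ((y1 - y2) / 2) by field.
  by rewrite sinN !sqrrN.
case=> ypos spos; have y20 : 0 < y2 by rewrite -(pmulr_rgt0 _ y10).
rewrite (gtr0_norm y10) (gtr0_norm y20) => ypi hyp.
pose D := (y1 - y2) / 2; pose S := (y1 + y2) / 2.
have sD : sin y1 * sin y2 = sin S ^+ 2 - sin D ^+ 2 by exact: sin_mul.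
have yD : y1 * y2 = S ^+ 2 - D ^+ 2 by rewrite /S /D; field.
pose p := if D == 0 then 1 else (sin D / D) ^+ 2.
have pE : p * D ^+ 2 = sin D ^+ 2.
  rewrite /p; case: eqVneq => [->|D0]; first by rewrite sin0 mul1r.
  by rewrite -exprMn divfK.
have p1 : 0 <= p <= 1.
  rewrite /p; case: eqVneq => [_|D0]; first by rewrite ler01 lexx.
  rewrite sqr_ge0/= exprMn exprVn ler_pdivrMr ?exprn_even_gt0// mul1r.
  exact: sqr_sin_le.
have pi0 := @pi_gt0 R; have pi4 := @pihalf_lt2 R.
have Dpi : - (pi / 2) <= D <= pi / 2.
  by move: ypi; rewrite /D ler_norml; lra.
have absD : D != 0 -> p = (sin `|D| / `|D|) ^+ 2.
  move=> D0; rewrite /p (negbTE D0).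
  by have [_|_] := ger0P D => //; rewrite sinN !invrN mulrNN.
have ppi : 4 <= pi ^+ 2 * p.
  have [D0|D0] := eqVneq D 0.
    by rewrite /p D0 eqxx; have := @pi_ge2 R; nra.
  rewrite absD//; have := @sinc_ge `|D|.
  rewrite normr_gt0 D0 ler_norml Dpi => /(_ erefl).
  by move: (sin _ / _) => q hq; rewrite -exprMn; nra.
have p4 : 1 / 4 <= p by nra.
have s1 : sin y1 * sin y2 <= 1.
  by have := sin_max y1; have := sin_max y2; rewrite !ler_norml; nra.
have sy : sin y1 * sin y2 <= y1 * y2.
  have h1 := sqr_sin_le y1; have h2 := sqr_sin_le y2.
  have : (sin y1 * sin y2) ^+ 2 <= (y1 * y2) ^+ 2.
    by rewrite !exprMn ler_pM ?sqr_ge0.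
  by rewrite ler_pXn2r// nnegrE ltW.
(* the excess [c] is 0 or the full one, according to whether [y1] is wide *)
have claim (c : R) : 0 <= c <= gain_excess -> c = 0 \/ 1 / 2 <= y1 ->
    (1 + c) * (sin y1 * sin y2) <= p * (y1 * y2).
  move=> /andP[c0 c1] hc; case: hyp => [[y1pi y2pi]|[y1pi y2pi]]; last first.
    have hpp : pi ^+ 2 <= y1 * y2 by rewrite ler_pM// ltW.
    have p0 : 0 <= p by case/andP: p1.
    have h4 : pi ^+ 2 * p <= p * (y1 * y2) by rewrite mulrC ler_wpM2l.
    have h2 : (1 + c) * (sin y1 * sin y2) <= 2 * 1.
      have [_ e1] := gain_excess_bounds; have /andP[_ k1] := sinc_rate_bounds R.
      by rewrite ler_pM ?(ltW spos)//; clear -c0 c1 e1 k1; lra.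
    by clear -h2 hpp p0 h4 ppi; lra.
  have [D0|D0] := eqVneq D 0.
    have e : y2 = y1 by move: D0; rewrite /D; lra.
    rewrite /p D0 eqxx mul1r e -!expr2; case: hc => [->|hc].
      by rewrite addr0 mul1r sqr_sin_le.
    have := @sqr_sin_le_excess y1; rewrite hc y1pi => /(_ erefl).
    by have := sqr_ge0 (sin y1); nra.
  have DS : `|D| <= S by rewrite ler_norml /D /S; lra.
  have D0' : 0 < `|D| by rewrite normr_gt0.
  have S0 : 0 < S by rewrite (lt_le_trans D0').
  have Spi : S <= pi by rewrite /S; lra.
  have := @sinc_decr R `|D| S; rewrite D0' DS => /(_ erefl Spi).
  have /sinc_ge_half A2 : 0 < `|D| <= pi / 2 by rewrite D0' ler_norml Dpi.
  rewrite absD// in pE *.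
  have B0 : 0 <= sin S / S.
    by rewrite divr_ge0 ?(ltW S0)// sin_ge0_pi// (ltW S0).
  have sS : sin S ^+ 2 = (sin S / S) ^+ 2 * S ^+ 2.
    by rewrite -exprMn divfK ?gt_eqF.
  rewrite real_normK ?num_real// => hA.
  have [e0 e1] := gain_excess_bounds.
  apply: (@sinc_gap_algebra _ (sin S / S) (S ^+ 2) _ _ _ (sinc_rate R)) => //; rewrite ?sqr_ge0//.
  - by rewrite yD; clear -hA; lra.
  - by rewrite sD yD sS -pE; ring.
  - by rewrite ltW; case/andP: (sinc_rate_bounds R).
  - by clear -c1 e1; lra.
  - case: hc => hc; [by left|right].
    have -> : 1 / 16 = (1 / 4) ^+ 2 :> R by field.
    by rewrite lerXn2r ?nnegrE// /S; clear -hc y20; lra.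
exists p; split => //.
rewrite /gain; case: ltP => hy.
  have [e0 _] := gain_excess_bounds.
  by have := claim 0; rewrite addr0 mul1r; apply; [lra|left].
have [e0 _] := gain_excess_bounds.
rewrite maxEle; case: ifP => _; last by apply: claim; [lra|right].
have s2 : sin y1 * sin y2 = `|sin y1| * `|sin y2| by rewrite -normrM gtr0_norm.
have sy1 : `|sin y1| != 0.
  by rewrite normr_eq0; apply: contraTneq spos => ->; rewrite mul0r ltxx.
have -> : y1 / `|sin y1| / 4 * (sin y1 * sin y2) = y1 / 4 * `|sin y2|.
  by rewrite s2; field.
have : `|sin y2| <= y2.
  have := sqr_sin_le y2; rewrite -[sin y2 ^+ 2]real_normK ?num_real//.
  by rewrite ler_pXn2r ?nnegrE// ltW.
by nra.
Qed.
(** The quantity [|z - w| ^ 2 / (Im z * Im w)] is a function of the hyperbolic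
distance, cleared of denominators here; it grows by the factor [gain] under [exp]. *)
Lemma expC_pair_gain x1 y1 x2 y2 : same_half_strip y1 y2 ->
  gain `|y1| * ((x1 - x2) ^+ 2 + (y1 - y2) ^+ 2) *
    (expR x1 * sin y1 * (expR x2 * sin y2)) <=
  ((expR x1 * cos y1 - expR x2 * cos y2) ^+ 2 +
   (expR x1 * sin y1 - expR x2 * sin y2) ^+ 2) * (y1 * y2).
Proof.
move=> hy; have [p [/andP[p0 p1] pE pg]] := vertical_gain hy.
case: hy => ypos spos _ _; rewrite expC_sqr_dist -pE.
have -> : expR x1 * sin y1 * (expR x2 * sin y2) =
  expR (x1 + x2) * (sin y1 * sin y2) by rewrite expRD; ring.
have hX := expR_sqrB x1 x2; have e0 := expR_gt0 (x1 + x2).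
have -> : p * ((y1 - y2) / 2) ^+ 2 = p * (y1 - y2) ^+ 2 / 4 by field.
move: (expR (x1 + x2)) (sin y1 * sin y2) (gain _) pg spos hX e0 => E s g pg s0 hX e0.
apply: (@le_trans _ _ (p * (y1 * y2) * (E * ((x1 - x2) ^+ 2 + (y1 - y2) ^+ 2)))).
  rewrite [leLHS](_ : _ = (g * s) * (E * ((x1 - x2) ^+ 2 + (y1 - y2) ^+ 2))); last ring.
  by rewrite ler_wpM2r// mulr_ge0 ?(ltW e0) ?addr_ge0 ?sqr_ge0.
rewrite [leLHS](_ : _ = (p * (E * ((x1 - x2) ^+ 2 + (y1 - y2) ^+ 2))) * (y1 * y2)); last ring.
rewrite ler_wpM2r ?(ltW ypos)//.
have : p * (E * (x1 - x2) ^+ 2) <= 1 * (E * (x1 - x2) ^+ 2).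
  by rewrite ler_wpM2r// mulr_ge0 ?(ltW e0) ?sqr_ge0.
lra.
Qed.

End pair_expansion.

(** * Growth of the gains along an orbit *)

Section gain_along_orbit.
Variable R : realType.
Implicit Types a b : R.

Lemma gain_ge1 a : 1 <= gain a.
Proof.
rewrite /gain; case: ifP => // _; rewrite le_max.
by have [e0 _] := gain_excess_bounds R; rewrite lerDl ltW.
Qed.

Lemma gain_wide a : 1 / 2 <= a -> 1 + gain_excess R <= gain a /\ a / `|sin a| <= 4 * gain a.
Proof.
rewrite leNgt => /negbTE h; rewrite /gain h /= le_max lexx; split => //.
have : a / `|sin a| / 4 <= Num.max (1 + gain_excess R) (a / `|sin a| / 4).
  by rewrite le_max lexx orbT.
by move: (Num.max _ _) => q; move: (a / `|sin a|) => w; lra.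
Qed.

Lemma narrow_trig a : 0 < a < 1 / 2 ->
  [/\ 7 / 8 <= cos a, 7 / 8 * a <= `|sin a| & cos a * a <= `|sin a|].
Proof.
move=> /andP[a0 a1].
have c : 7 / 8 <= cos a.
  have := cos_ge1B a; have : a ^+ 2 <= (1 / 2) ^+ 2 by rewrite lerXn2r ?nnegrE; lra.
  have -> : (1 / 2) ^+ 2 = 1 / 4 :> R by field.
  by lra.
have s : cos a * a <= `|sin a|.
  rewrite mulrC (le_trans _ (ler_norm _))// xcos_le_sin// (ltW a0)/=.
  by have := pi_ge2 R; lra.
by split => //; apply: le_trans s; rewrite ler_wpM2r// ltW.
Qed.

(** In a narrow run the real part is multiplied by at least [3 / 2] at each step. *)
Lemma expR_ge_lin a : 0 <= a -> 3 / 2 * a <= 7 / 8 * expR a.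
Proof.
move=> a0; have -> : a = a / 2 + a / 2 by field.
rewrite expRD; have := expR_ge1Dx (a / 2); have : 0 <= a / 2 by lra.
move: (a / 2) => b b0 hb.
have : (1 + b) * (1 + b) <= expR b * expR b by rewrite ler_pM//; lra.
have : 0 <= (b - 1) ^+ 2 by exact: sqr_ge0.
have -> : (b - 1) ^+ 2 = b ^+ 2 - 2 * b + 1 by ring.
have -> : (1 + b) * (1 + b) = b ^+ 2 + 2 * b + 1 by ring.
move: (b ^+ 2) (expR b * expR b) => q w; lra.
Qed.

(** Real part [x] and absolute value [u] of the imaginary part along an orbit that
never meets the real axis. *)
Section orbit.
Variables x u : nat -> R.
Hypothesis hx : forall j, x j.+1 = expR (x j) * cos (u j).
Hypothesis hu : forall j, u j.+1 = expR (x j) * `|sin (u j)|.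
Hypothesis u0 : forall j, 0 < u j.

(** Infinitesimal expansion factor of [exp] in the half-plane metric. *)
Let stretch j := u j / `|sin (u j)|.

Lemma sin_u_gt0 j : 0 < `|sin (u j)|.
Proof. by have := u0 j.+1; rewrite hu pmulr_rgt0// expR_gt0. Qed.

Lemma sin_le_u j : `|sin (u j)| <= u j.
Proof.
have := sqr_sin_le (u j); rewrite -[sin _ ^+ 2]real_normK ?num_real//.
by rewrite ler_pXn2r ?nnegrE// ltW.
Qed.

Lemma stretch_ge1 j : 1 <= stretch j.
Proof. by rewrite /stretch ler_pdivlMr ?sin_u_gt0// mul1r sin_le_u. Qed.

Lemma stretch_ge_u j : u j <= stretch j.
Proof.
rewrite /stretch ler_pdivlMr ?sin_u_gt0// ler_piMr ?(ltW (u0 j))//.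
exact: sin_max.
Qed.

Lemma narrow_step j : u j < 1 / 2 ->
  7 / 8 * expR (x j) <= x j.+1 /\ x j.+1 * u j <= u j.+1.
Proof.
move=> uj; have [|c _ s] := @narrow_trig (u j); first by rewrite u0.
rewrite hx hu; split; first by rewrite mulrC ler_wpM2l// expR_ge0.
by rewrite -mulrA ler_wpM2l// expR_ge0.
Qed.

(** While [u < 1/2] we have [tan u >= u], hence [u] is multiplied by at least the
next real part at each step. The real part is nonnegative after two steps, at least
[7 / 8] after three, and then grows geometrically; the last step alone multiplies [u]
by the exponential of it. *)
Lemma narrow_run_escape (a r : nat) : (forall l, (a < l <= a + r + 4)%N -> u l < 1 / 2) ->
  u (a + 2)%N * expR (7 / 8 * (3 / 2) ^+ r) <= 1.
Proof.
move=> small.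
have st l : (a < l <= a + r + 4)%N ->
  7 / 8 * expR (x l) <= x l.+1 /\ x l.+1 * u l <= u l.+1.
  by move=> /small/narrow_step.
have hX s : (s <= r)%N -> 7 / 8 * (3 / 2) ^+ s <= x (a + 3 + s)%N /\
    7 / 8 * u (a + 2)%N <= u (a + 3 + s)%N.
  elim: s => [_|s IH sr].
    have [|h1 _] := st (a + 1)%N; first lia.
    have [|h2 h3] := st (a + 2)%N; first lia.
    rewrite addn0 expr0 -(addn1 (a + 2)) -addnA/= in h2 h3 *.
    rewrite -(addn1 (a + 1)) -addnA/= in h1.
    have hx0 : 0 <= x (a + 2)%N by have := expR_ge0 (x (a + 1)%N); lra.
    have hx1 : 7 / 8 <= x (a + 3)%N by have := expR_ge1Dx (x (a + 2)%N); lra.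
    split; first lra.
    by apply: le_trans h3; rewrite ler_wpM2r// ltW.
  have [h1 h2] := IH (ltnW sr).
  have [|h3 h4] := st (a + 3 + s)%N; first lia.
  rewrite addnS.
  have p0 : 1 <= (3 / 2) ^+ s :> R by rewrite exprn_ege1//; lra.
  have xp : 0 <= x (a + 3 + s)%N by lra.
  have hx1 : 3 / 2 * x (a + 3 + s)%N <= x (a + 3 + s).+1.
    by apply: le_trans h3; exact: expR_ge_lin.
  split; first by rewrite exprS; lra.
  apply: (le_trans h2); apply: le_trans h4.
  by rewrite ler_peMl ?(ltW (u0 _))//; lra.
have [h1 h2] := hX r (leqnn _).
have [|h3 h4] := st (a + 3 + r)%N; first lia.
have : u (a + 3 + r).+1 < 1 / 2 by apply: small; lia.
have e1 : expR (7 / 8 * (3 / 2) ^+ r) <= expR (x (a + 3 + r)%N) by rewrite ler_expR.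
have : (7 / 8 * expR (7 / 8 * (3 / 2) ^+ r)) * (7 / 8 * u (a + 2)%N) <=
  x (a + 3 + r).+1 * u (a + 3 + r)%N.
  rewrite ler_pM//.
  - by rewrite mulr_ge0 ?(ltW (u0 _)) ?divr_ge0.
  - by apply: le_trans h3; rewrite ler_wpM2l//; lra.
have -> : (7 / 8 * expR (7 / 8 * (3 / 2) ^+ r)) * (7 / 8 * u (a + 2)%N) =
  49 / 64 * (u (a + 2)%N * expR (7 / 8 * (3 / 2) ^+ r)) by field.
move: (_ * expR _) => q; lra.
Qed.

(** Up to a constant, the height two steps after a wide time is at least the inverse
of [exp (exp x - x + stretch)], because the intermediate real part is at least
[- exp x]; and [exp x] itself is paid for by the stretch. *)
Lemma narrow_run_start j : 1 / 2 <= u j -> u j.+1 < 1 / 2 ->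
  expR (- (2 + expR (x j) - x j + stretch j)) <= u j.+2 /\ expR (x j) <= stretch j.
Proof.
move=> uj uj1; have s0 := sin_u_gt0 j; split; last first.
  by rewrite /stretch ler_pdivlMr// -hu; lra.
have [|_ s _] := @narrow_trig (u j.+1); first by rewrite u0.
rewrite hu; have hX : - expR (x j) <= x j.+1.
  by rewrite hx -subr_ge0 opprK -[X in _ + X]mulr1 -mulrDr mulr_ge0 ?expR_ge0.
have -> : - (2 + expR (x j) - x j + stretch j) = - expR (x j) + (x j - (2 + stretch j)) by ring.
rewrite expRD ler_pM ?expR_ge0 ?ler_expR//; apply: le_trans s.
rewrite hu expRB mulrCA ler_wpM2l ?expR_ge0//.
rewrite -[leLHS]mul1r ler_pdivrMr ?expR_gt0//.
have sh : `|sin (u j)| * stretch j = u j by rewrite /stretch mulrCA divff ?mulr1// gt_eqF.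
have e4 : 4 * stretch j <= expR (2 + stretch j).
  have -> : 2 + stretch j = 1 + (1 + stretch j) by ring.
  rewrite expRD expRD mulrA; have e1 := expR_ge1Dx (1 : R).
  have h1 := expR_ge1Dx (stretch j); have := stretch_ge1 j => h0.
  rewrite ler_pM//; [lra| |lra].
  have h2 : 2 * 2 <= expR 1 * expR 1 :> R by apply: ler_pM; lra.
  by apply: le_trans h2; lra.
have : 7 / 8 * `|sin (u j)| * (4 * stretch j) <= 7 / 8 * `|sin (u j)| * expR (2 + stretch j).
  by rewrite ler_wpM2l// mulr_ge0//; lra.
have -> : 7 / 8 * `|sin (u j)| * (4 * stretch j) = 7 / 2 * (`|sin (u j)| * stretch j) by field.
rewrite sh; lra.
Qed.

(** A negative real part is produced by a wide point, and its size is at most the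
modulus, which is paid for by the stretches of this step and of the next one. *)
Lemma negative_step j : x j.+1 < 0 ->
  [/\ 1 <= u j, - x j.+1 <= expR (x j) & expR (x j) <= stretch j * stretch j.+1].
Proof.
rewrite hx => xn; have e0 := expR_gt0 (x j); have s0 := sin_u_gt0 j.
have cn : cos (u j) < 0 by move: xn; rewrite pmulr_rlt0.
have uj : 1 <= u j.
  rewrite leNgt; apply/negP => u1.
  have : 0 < cos (u j).
    apply: cos_gt0_pihalf; have := u0 j; have := pihalf_ge1 R; lra.
  lra.
split; first by [].
  by rewrite -mulrN ler_piMr ?expR_ge0 // lerNl.
have e : expR (x j) = u j.+1 / `|sin (u j)| by rewrite hu mulfK// gt_eqF.
rewrite {1}e /stretch -/(stretch j.+1) [_ * stretch j.+1]mulrC.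
rewrite ler_pM ?invr_ge0 ?(ltW (u0 _)) ?(ltW s0)//; first exact: stretch_ge_u.
by rewrite ler_peMl ?invr_ge0 ?(ltW s0).
Qed.

(** There is no previous step at time 0; the value 1 keeps products unchanged. *)
Let prev_gain j := if j is j'.+1 then gain (u j') else 1.

(** Combine [narrow_run_escape] and [narrow_run_start]: the exponent [(3/2) ^ m] is at most
[exp x - x + stretch], up to constants. The first and last terms are at most the
stretch of the present step; if [- x] is large, it is at most the product of the
stretches of the previous and of the present step. *)
Lemma narrow_run_gain j m : -1 <= x 0%N -> 1 / 2 <= u j ->
  (forall l, (j < l <= j + m)%N -> u l < 1 / 2) ->
  (3 / 2) ^+ m <= 500 * (prev_gain j * gain (u j)).
Proof.
move=> x0 uj small.
have pg1 : 1 <= prev_gain j by rewrite /prev_gain; case: j {uj small} => // j; exact: gain_ge1.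
have gg1 : 1 <= prev_gain j * gain (u j) by rewrite mulr_ege1// gain_ge1.
have g1 : gain (u j) <= prev_gain j * gain (u j).
  by rewrite ler_peMl// (le_trans ler01)// gain_ge1.
have [m3|m4] := leqP m 3.
  have : (3 / 2) ^+ m <= (3 / 2) ^+ 3 :> R by rewrite ler_weXn2l//; lra.
  have -> : (3 / 2) ^+ 3 = 27 / 8 :> R by field.
  by lra.
have [r mE] : exists r, m = (r + 4)%N by exists (m - 4)%N; rewrite subnK.
clear m4; rewrite {m}mE addnA in small *.
have := narrow_run_escape small.
have [|us es] := narrow_run_start uj; first by apply: small; lia.
have [_ hg] := gain_wide uj; rewrite -/(stretch j) in hg.
rewrite addn2 => hle.
have T : 7 / 8 * (3 / 2) ^+ r <= 2 + expR (x j) - x j + stretch j.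
  rewrite -subr_le0 -expR_le1 expRD.
  by apply: le_trans hle; rewrite mulrC ler_wpM2r ?expR_ge0.
have hX : - x j <= 1 + 16 * (prev_gain j * gain (u j)).
  have [xj|xj] := leP (- 1) (x j); first lra.
  case: j xj uj hg {small us es g1 pg1 T hle} gg1 => [|j]; first lra.
  move=> xj uj hg gg1 /=; have [|u1 e1 e2] := @negative_step j; first lra.
  have [|_ hg'] := @gain_wide (u j); first lra.
  rewrite -/(stretch j) in hg'.
  have : stretch j * stretch j.+1 <= (4 * gain (u j)) * (4 * gain (u j.+1)).
    by rewrite ler_pM// (le_trans ler01)// stretch_ge1.
  by lra.
rewrite exprD.
have -> : (3 / 2) ^+ 4 = 81 / 16 :> R by field.
lra.
Qed.

Let L n := \prod_(i < n) gain (u i).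

Lemma L_ge1 n : 1 <= L n.
Proof. by rewrite /L; elim/big_ind: _ => // [a b|i _]; [exact: mulr_ege1|exact: gain_ge1]. Qed.

Lemma LS n : L n.+1 = L n * gain (u n).
Proof. by rewrite /L big_ord_recr. Qed.

Lemma L_mono m n : (m <= n)%N -> L m <= L n.
Proof.
move=> /subnK <-; elim: (n - m)%N => [//|k IH].
by rewrite addSn LS (le_trans IH)// ler_peMr ?gain_ge1// (le_trans ler01)// L_ge1.
Qed.

(** Induction on the wide times. From a wide time [j] to the next one, the product
[L j * L j.-1] gains the factors of the steps [j - 1] and [j], which by
[narrow_run_gain] control the number of elapsed steps. *)
Lemma gain_growth N i : 500 * (3 / 2) <= (1 + gain_excess R) ^+ N -> -1 <= x 0%N -> 1 / 2 <= u 0%N ->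
  1 / 2 <= u i -> (3 / 2) ^+ i <= L i ^+ (2 * N.+1).
Proof.
move=> hN x0 u00.
(* one run consumes the gains of two steps, so each gain may serve twice *)
pose Psi j := L j * L j.-1.
have Psi_ge1 j : 1 <= Psi j by rewrite mulr_ege1 ?L_ge1.
have main n : exists j, [/\ (j <= n)%N, 1 / 2 <= u j,
    (forall l, (j < l <= n)%N -> u l < 1 / 2) & (3 / 2) ^+ j <= Psi j ^+ N.+1].
  elim: n => [|n [j [jn uj small hj]]].
    exists 0%N; split => //; first lia.
    by rewrite expr0 exprn_ege1.
  have [un|un] := ltP (u n.+1) (1 / 2).
    exists j; split => //; first exact: leqW.
    by move=> l /andP[jl]; rewrite leq_eqVlt => /predU1P[->//|ln]; apply: small; lia.
  exists n.+1; split => //; first lia.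
  pose g := prev_gain j * gain (u j).
  have gg : (3 / 2) ^+ (n - j) <= 500 * g.
    by apply: narrow_run_gain => // l hl; apply: small; lia.
  have [ge1 _] := gain_wide uj.
  have pg1 : 1 <= prev_gain j by rewrite /prev_gain; case: (j) => // k; exact: gain_ge1.
  have g1 : 1 + gain_excess R <= g.
    by rewrite /g (le_trans ge1)// ler_peMl// (le_trans ler01)// gain_ge1.
  have [e0 _] := gain_excess_bounds R.
  have PsiS : Psi j * g <= Psi n.+1.
    have -> : Psi j * g = L j.+1 * (L j.-1 * prev_gain j) by rewrite /Psi /g LS; ring.
    rewrite /Psi /= ler_pM//.
    - by rewrite (le_trans ler01)// L_ge1.
    - by rewrite mulr_ge0// ?(le_trans ler01)// L_ge1.
    - exact: L_mono.
    - have -> : L j.-1 * prev_gain j = L j.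
        by case: (j) => [|k] /=; [rewrite mulr1|rewrite LS].
      exact: L_mono.
  (* [N] copies of [g] absorb the constant 500, the last one pays for the run *)
  have gN : (3 / 2) ^+ (n - j).+1 <= g ^+ N.+1.
    have h1 : 500 * (3 / 2) <= g ^+ N.
      by apply: le_trans hN _; rewrite lerXn2r// nnegrE; lra.
    rewrite exprSr exprS; apply: (@le_trans _ _ (g * (500 * (3 / 2)))); first lra.
    by rewrite ler_wpM2l//; lra.
  have nE : (j + (n - j).+1 = n.+1)%N by rewrite addnS subnKC.
  rewrite -[X in (3 / 2) ^+ X]nE exprD.
  apply: (@le_trans _ _ ((Psi j * g) ^+ N.+1)).
    by rewrite [leRHS]exprMn; apply: ler_pM; rewrite ?exprn_ge0//; lra.
  rewrite lerXn2r// nnegrE ?(le_trans ler01)//.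
  by rewrite mulr_ege1//; lra.
move=> ui; have [j [ji uj small hj]] := main i.
have ij : j = i.
  apply/eqP; rewrite eqn_leq ji leqNgt; apply/negP => lt.
  by have := small i; rewrite lt leqnn => /(_ erefl); lra.
rewrite ij in hj; apply: (le_trans hj).
rewrite exprM lerXn2r ?nnegrE ?exprn_ge0 ?(le_trans ler01)// ?L_ge1//.
rewrite /Psi expr2 ler_wpM2l ?(le_trans ler01) ?L_ge1//.
by apply: L_mono; exact: leq_pred.
Qed.

(** Otherwise [narrow_run_escape] would apply to arbitrarily long runs. *)
Lemma wide_infinitely_often n : exists2 j, (n <= j)%N & 1 / 2 <= u j.
Proof.
apply: contrapT => H.
have small l : (n <= l)%N -> u l < 1 / 2.
  by move=> nl; rewrite ltNge; apply/negP => ul; apply: H; exists l.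
have esc r : u (n + 2)%N * expR (7 / 8 * (3 / 2) ^+ r) <= 1.
  by apply: narrow_run_escape => l hl; apply: small; lia.
have p0 := u0 (n + 2)%N.
pose r := Num.bound (4 / u (n + 2)%N).
have hr : 4 / u (n + 2)%N < r%:R by rewrite archi_boundP// divr_ge0// ltW.
have hb : 1 + r%:R / 2 <= (3 / 2) ^+ r :> R.
  elim: (r) => [|k IH]; first by rewrite expr0; lra.
  rewrite exprS; have : 0 <= k%:R :> R by [].
  by rewrite -natr1; lra.
have r0 : 0 <= r%:R :> R by [].
have e := expR_ge1Dx (7 / 8 * (3 / 2) ^+ r : R).
have : u (n + 2)%N * (r%:R / 4) <= 1.
  by apply: le_trans (esc r); rewrite ler_wpM2l ?(ltW p0)//; lra.
move: hr; rewrite ltr_pdivrMr//; lra.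
Qed.

(** A wide time with a very negative real part is preceded by a wide time with
positive real part, by [negative_step]. *)
Lemma good_infinitely_often n :
  exists2 j, (n <= j)%N & 1 / 2 <= u j /\ - 1 <= x j.
Proof.
have [[//|j] nj uj] := wide_infinitely_often n.+1.
have [xj|xj] := leP (- 1) (x j.+1); first by exists j.+1 => //; lia.
have [|u1 e1 e2] := @negative_step j; first lra.
exists j; first lia.
split; first lra.
rewrite leNgt; apply/negP => xj1.
by have : expR (x j) < 1; [rewrite expR_lt1; lra|lra].
Qed.

End orbit.
End gain_along_orbit.

(** * Hausdorff content and null sets *)

Section hausdorff_content.
Variable R : realType.
Implicit Types (A B : set R[i]) (s d : R).
Local Notation normc := (@Normc.normc R).

Let T := g_sigma_algebraType [set: set (R[i])^o].

(** The Hausdorff content, where no bound is put on the diameters of the covering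
sets. It is an instance of the construction of outer measures, over the
sigma-algebra of all sets, which provides its countable subadditivity. *)
Definition content s : set R[i] -> \bar R := @mu_ext _ T R (diam_pow s).

Lemma diameter_ge0 A : (0 <= diameter A)%E.
Proof. by apply: ereal_sup_ubound; left. Qed.

Lemma diam_pow_ge0 s A : (0 <= diam_pow s A)%E.
Proof. by rewrite /diam_pow; case: ifP => // _; exact: poweR_ge0. Qed.

Lemma diam_pow0 s : diam_pow s (set0 : set R[i]) = 0%E.
Proof. by rewrite /diam_pow eqxx. Qed.

Lemma diameter_le A d : 0 <= d ->
  (forall z w, A z -> A w -> normc (z - w) <= d) -> (diameter A <= d%:E)%E.
Proof.
move=> d0 h; apply: ge_ereal_sup => _ [->|[[z w] /= [Az Aw] <-]]; rewrite lee_fin//.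
exact: h.
Qed.

Lemma diameter_ge A z w : A z -> A w -> ((normc (z - w))%:E <= diameter A)%E.
Proof. by move=> Az Aw; apply: ereal_sup_ubound; right; exists (z, w). Qed.

Lemma diam_pow_le s A (y : \bar R) : 0 <= s -> (0 <= y)%E ->
  (diameter A <= y)%E -> (diam_pow s A <= y `^ s)%E.
Proof.
move=> s0 y0 Ay; rewrite /diam_pow; case: ifP => _; first exact: poweR_ge0.
by apply: gt0_ler_poweR => //; rewrite in_itv/= ?leey ?diameter_ge0 ?y0.
Qed.

Lemma content_ge0 s A : (0 <= content s A)%E.
Proof. by apply: mu_ext_ge0 => B; exact: diam_pow_ge0. Qed.

Lemma content_mono s A B : A `<=` B -> (content s A <= content s B)%E.
Proof. by move=> AB; exact: le_mu_ext. Qed.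

Lemma measurable_all (B : set T) : measurable B.
Proof. by apply: sub_sigma_algebra. Qed.

Lemma content_cover s A (U : (set R[i])^nat) : A `<=` \bigcup_j U j ->
  (content s A <= \sum_(j <oo) diam_pow s (U j))%E.
Proof.
move=> AU; apply: ereal_inf_lbound; exists U => //; split => //.
by move=> i; exact: measurable_all.
Qed.

Lemma content_bigcup s (F : (set R[i])^nat) :
  (content s (\bigcup_n F n) <= \sum_(n <oo) content s (F n))%E.
Proof.
by apply: mu_ext_sigma_subadditive => B; exact: diam_pow_ge0.
Qed.

Lemma content0 s : content s set0 = 0%E.
Proof. by apply: mu_ext0 => [|B]; [exact: diam_pow0|exact: diam_pow_ge0]. Qed.

Lemma content_diam s A d : 0 <= s -> 0 <= d ->
  (forall z w, A z -> A w -> normc (z - w) <= d) ->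
  (content s A <= (d `^ s)%:E)%E.
Proof.
move=> s0 d0 hA.
apply: (le_trans (@content_cover s A (fun j => if j == 0%N then A else set0) _)).
  by move=> z Az; exists 0%N.
rewrite (nneseries_recl (P := xpredT))//; last by move=> *; exact: diam_pow_ge0.
rewrite [X in (_ + X)%E]eseries0 ?adde0; last first.
  by move=> [|j] // _ _; rewrite diam_pow0.
by rewrite -poweR_EFin diam_pow_le// ?lee_fin// diameter_le.
Qed.

Lemma content_finite s A (F : (set R[i])^nat) n (a : R) :
  (forall k, (content s (F k) <= a%:E)%E) ->
  A `<=` \bigcup_(k < n) F k -> (content s A <= (n%:R * a)%:E)%E.
Proof.
move=> Fa AF; pose G k := if (k < n)%N then F k else set0.
apply: (@le_trans _ _ (content s (\bigcup_k G k))).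
  apply: content_mono => z /AF[k /= kn Fz]; exists k => //.
  by rewrite /G kn.
apply: (le_trans (content_bigcup _ _)).
rewrite (nneseries_split 0 n); last by move=> k _; exact: content_ge0.
rewrite add0n [X in (_ + X)%E]eseries0 ?adde0; last first.
  by move=> k nk _; rewrite /G ltnNge nk content0.
rewrite big_mkord.
apply: (@le_trans _ _ (\sum_(i < n) a%:E)%E).
  by apply: lee_sum => k _; rewrite /G ltn_ord.
by rewrite sumEFin sumr_const card_ord mulr_natl.
Qed.

(** Cut along [g] into [n] slices of unit width. *)
Lemma content_slices s A (g : R[i] -> R) n d : 0 <= s -> 0 <= d ->
  (forall z, A z -> 0 <= g z < n%:R) ->
  (forall z w, A z -> A w -> `|g z - g w| <= 1 -> normc (z - w) <= d) ->
  (content s A <= (n%:R * d `^ s)%:E)%E.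
Proof.
move=> s0 d0 gA hA.
apply: (@content_finite _ _ (fun k => [set z | A z /\ k%:R <= g z < k.+1%:R])).
  move=> k; apply: content_diam => // z w [Az /andP[z1 z2]] [Aw /andP[w1 w2]].
  apply: hA => //; rewrite ler_norml.
  by rewrite -natr1 in z2 w2; lra.
move=> z Az; have /andP[g0 gn] := gA z Az.
have /andP[t1 t2] := truncn_itv g0.
by exists (Num.truncn (g z)) => /=; [rewrite -(ltr_nat R) (le_lt_trans t1)|rewrite t1 t2].
Qed.

Lemma geometric_series_le (a r : R) : 0 <= a -> 0 < r < 1 ->
  (\sum_(j <oo) (a * r ^+ j)%:E <= (a / (1 - r))%:E)%E.
Proof.
move=> a0 /andP[r0 r1]; apply: lime_le.
  by apply: is_cvg_nneseries => n _ _; rewrite lee_fin mulr_ge0// exprn_ge0// ltW.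
near=> n; rewrite sumEFin lee_fin.
have := @geometric_le_lim R n a r a0 r0.
by rewrite gtr0_norm// => /(_ r1).
Unshelve. all: by end_near. Qed.

(** For [0 < s] this is equivalent to the vanishing of the Hausdorff measure, since a
small sum of [diam ^ s] forces every diameter to be small. *)
Definition null s A := content s A = 0%E.

Lemma null_sub s A B : A `<=` B -> null s B -> null s A.
Proof.
move=> AB nB; apply/eqP; rewrite eq_le content_ge0 andbT -nB.
exact: content_mono.
Qed.

Lemma null_bigcup s (F : (set R[i])^nat) :
  (forall n, null s (F n)) -> null s (\bigcup_n F n).
Proof.
move=> nF; apply/eqP; rewrite eq_le content_ge0 andbT.
apply: (le_trans (content_bigcup _ _)).
by rewrite eseries0// => i _ _; exact: nF.
Qed.

Lemma null_setU s A B : null s A -> null s B -> null s (A `|` B).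
Proof.
move=> nA nB; apply: (@null_sub _ _ (\bigcup_n (if n == 0%N then A else B))).
  by move=> z [Az|Bz]; [exists 0%N|exists 1%N].
by apply: null_bigcup => -[|n].
Qed.

Lemma null_small s A : (forall e : R, 0 < e -> (content s A <= e%:E)%E) -> null s A.
Proof.
move=> h; apply/eqP; rewrite eq_le content_ge0 andbT.
by apply/lee_addgt0Pr => e e0; rewrite add0e h.
Qed.

Lemma null_cover s A (e : R) : 0 < e -> null s A ->
  exists2 U : (set R[i])^nat, A `<=` \bigcup_j U j &
    (\sum_(j <oo) diam_pow s (U j) < e%:E)%E.
Proof.
move=> e0 nA; have fA : content s A \is a fin_num by rewrite nA.
have [_ [U [mU AU] <-]] := lb_ereal_inf_adherent e0 fA.
by rewrite -[X in (X + _)%E]/(content s A) nA add0e; exists U.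
Qed.

Lemma null_lipschitz s A (F : R[i] -> R[i]) (C : R) : 0 < s -> 0 < C ->
  (forall z w, A z -> A w -> normc (z - w) <= C * normc (F z - F w)) ->
  null s (F @` A) -> null s A.
Proof.
move=> s0 C0 hF nFA; apply: null_small => e e0.
have C's : 0 < C `^ s by rewrite powR_gt0.
have [|U AU Ue] := @null_cover s _ (e / C `^ s) _ nFA; first by rewrite divr_gt0.
apply: (le_trans (@content_cover s A (fun j => A `&` F @^-1` U j) _)).
  by move=> z Az; have [|j _ Uj] := AU (F z); [exists z|exists j].
apply: (@le_trans _ _ ((C `^ s)%:E * \sum_(j <oo) diam_pow s (U j))%E); last first.
  have -> : e%:E = ((C `^ s)%:E * (e / C `^ s)%:E)%E.
    by rewrite -EFinM mulrCA divff ?mulr1// gt_eqF.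
  by rewrite lee_pmul2l// ?lte_fin// ltW.
rewrite -nneseriesZl; last by move=> *; exact: diam_pow_ge0.
apply: lee_nneseries => j _; first by move=> _; exact: diam_pow_ge0.
have [e'|/set0P[z [Az Uz]]] := eqVneq (A `&` F @^-1` U j) set0.
  by rewrite e' diam_pow0 mule_ge0 ?diam_pow_ge0 ?lee_fin ?powR_ge0.
have -> : diam_pow s (U j) = (diameter (U j) `^ s)%E.
  by rewrite /diam_pow; case: eqP => // U0; rewrite /= U0 in Uz.
rewrite -poweR_EFin -poweRM ?diameter_ge0 ?lee_fin ?(ltW C0)//.
apply: diam_pow_le; rewrite ?(ltW s0)// ?mule_ge0 ?diameter_ge0 ?lee_fin ?(ltW C0)//.
apply: ge_ereal_sup => _ [->|[[p q] /= [[Ap Up] [Aq Uq]] <-]].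
  by rewrite mule_ge0 ?diameter_ge0 ?lee_fin ?(ltW C0).
apply: (@le_trans _ _ (C * normc (F p - F q))%:E); first by rewrite lee_fin hF.
by rewrite EFinM lee_pmul2l// ?lte_fin// diameter_ge.
Qed.

(** A cover whose sum is less than [d ^ s] consists of sets of diameter at most [d]. *)
Lemma null_hausdorff_measure s A : 0 < s -> null s A -> hausdorff_measure s A = 0%E.
Proof.
move=> s0 nA; apply/eqP; rewrite eq_le; apply/andP; split; last first.
  apply: (@le_trans _ _ (hausdorff_premeasure s 1 A)).
    apply: le_ereal_inf_tmp => _ [U _ <-]; apply: nneseries_ge0 => *.
    exact: diam_pow_ge0.
  by apply: ereal_sup_ubound; exists 1 => //=.
apply: ge_ereal_sup => _ [d /= d0 <-]; apply/lee_addgt0Pr => e e0; rewrite add0e.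
have ds : 0 < d `^ s by rewrite powR_gt0.
have [|U AU Ue] := @null_cover s A (Num.min e (d `^ s)) _ nA.
  by rewrite lt_min e0 ds.
apply: (@le_trans _ _ (\sum_(j <oo) diam_pow s (U j))%E); last first.
  by apply: (le_trans (ltW Ue)); rewrite lee_fin ge_min lexx.
apply: ereal_inf_lbound; exists U => //=; split => // j.
have [U0|Un0] := eqVneq (U j) set0.
  by rewrite U0; apply: diameter_le => //; exact: ltW.
have hj : (diam_pow s (U j) < (d `^ s)%:E)%E.
  apply: (@le_lt_trans _ _ (\sum_(j <oo) diam_pow s (U j))%E).
    rewrite (nneseriesD1 (n := j))//; last by move=> *; exact: diam_pow_ge0.
    by rewrite leeDl//; apply: nneseries_ge0 => *; exact: diam_pow_ge0.
  by apply: (lt_le_trans Ue); rewrite lee_fin ge_min lexx orbT.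
rewrite leNgt; apply/negP => dU; move: hj; rewrite ltNge => /negP; apply.
rewrite /diam_pow (negbTE Un0) -poweR_EFin.
apply: gt0_ler_poweR; rewrite ?in_itv/= ?leey ?diameter_ge0 ?lee_fin ?(ltW d0) ?(ltW s0)//.
exact: ltW.
Qed.

Lemma hausdorff_dim_le1 A : (forall s, 1 < s -> null s A) -> (hausdorff_dim A <= 1)%E.
Proof.
move=> nA; apply/lee_addgt0Pr => e e0.
apply: ereal_inf_lbound; exists (1 + e) => //=; split; first by lra.
apply: null_hausdorff_measure; first by lra.
by apply: nA; lra.
Qed.

End hausdorff_content.

(** * Two orbits in the same half-strips *)

Section two_orbits.
Variable R : realType.
Implicit Types (A B : set R[i]) (z w : R[i]).
Local Notation normc := (@Normc.normc R).
Local Notation f := (@expC R).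
Local Notation Re := (@complex.Re R).
Local Notation Im := (@complex.Im R).

Definition re_iter n z := Re (iter n f z).
Definition im_iter n z := Im (iter n f z).

Lemma re_iterS n z : re_iter n.+1 z = expR (re_iter n z) * cos (im_iter n z). Proof. by []. Qed.
Lemma im_iterS n z : im_iter n.+1 z = expR (re_iter n z) * sin (im_iter n z). Proof. by []. Qed.

Definition sqdist n z w := (re_iter n z - re_iter n w) ^+ 2 + (im_iter n z - im_iter n w) ^+ 2.

Lemma normc_sqr z w : normc (z - w) ^+ 2 = sqdist 0 z w.
Proof.
rewrite /sqdist /re_iter /im_iter /=; case: z => a b; case: w => c d /=.
by rewrite sqr_sqrtr ?addr_ge0 ?sqr_ge0.
Qed.

Lemma normc_nonneg z : 0 <= normc z.
Proof. by case: z => a b /=; exact: sqrtr_ge0. Qed.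

Lemma normc_le z w (d : R) : 0 <= d -> sqdist 0 z w <= d ^+ 2 -> normc (z - w) <= d.
Proof. by move=> d0; rewrite -normc_sqr ler_pXn2r// nnegrE normc_nonneg. Qed.

Lemma powR_lt1 (a s : R) : 0 < a < 1 -> 0 < s -> 0 < a `^ s < 1.
Proof.
move=> /andP[a0 a1] s0; rewrite powR_gt0//=.
have -> : 1 = 1 `^ s :> R by rewrite powR1.
by rewrite gt0_ltr_powR// nnegrE// ltW.
Qed.

(** The ratio of the sum over dyadic scales: [2 ^ p] slices of relative size
[2 ^ (-p)]. This is where [1 < s] enters. *)
Lemma powR_half_lt1 (s : R) : 1 < s -> 0 < 2 * (1 / 2) `^ s < 1.
Proof.
move=> s1; have h0 : 0 < (1 / 2 : R) < 1 by lra.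
have /andP[h1 h2] := h0.
have /andP[p0 p1] : 0 < (1 / 2 : R) `^ (s - 1) < 1 by apply: powR_lt1 => //; lra.
have -> : (1 / 2) `^ s = 1 / 2 * (1 / 2) `^ (s - 1).
  by rewrite mulr_powRB1 ?(ltW h1)//; lra.
lra.
Qed.

Lemma powRX (a s : R) n : 0 <= a -> (a ^+ n) `^ s = (a `^ s) ^+ n.
Proof.
move=> a0; elim: n => [|n IH]; first by rewrite !expr0 powR1.
by rewrite !exprS powRM ?exprn_ge0// IH.
Qed.

Lemma pow_unbounded (c e : R) : 0 <= c -> 0 < e -> exists N, c <= (1 + e) ^+ N.
Proof.
move=> c0 e0; pose N := Num.bound (c / e); exists N.
have hb : c / e < N%:R by rewrite archi_boundP// divr_ge0// ltW.
have hi : 1 + N%:R * e <= (1 + e) ^+ N.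
  elim: (N) => [|k IH]; first by rewrite expr0 mul0r addr0.
  rewrite exprS -natr1.
  have k0 : 0 <= k%:R * e by rewrite mulr_ge0// ltW.
  apply: (@le_trans _ _ ((1 + e) * (1 + k%:R * e))).
    have : 0 <= e * (k%:R * e) by rewrite mulr_ge0// ltW.
    lra.
  by rewrite ler_wpM2l//; lra.
by move: hb; rewrite ltr_pdivrMr//; lra.
Qed.

(** At good times the half-plane metric is at most twice the Euclidean one, and the
next iterate is bounded away from 0. *)
Definition good n z := 1 / 2 <= `|im_iter n z| /\ - 1 <= re_iter n z.

Section core.
Variable A : set R[i].
Hypothesis hA : forall z w, A z -> A w -> forall n, same_half_strip (im_iter n z) (im_iter n w).

Let L n z := \prod_(i < n) gain `|im_iter i z|.

Lemma orbit_x z : forall j, re_iter j.+1 z = expR (re_iter j z) * cos `|im_iter j z|.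
Proof. by move=> j; rewrite re_iterS cos_norm. Qed.

Lemma orbit_u z : forall j, `|im_iter j.+1 z| = expR (re_iter j z) * `|sin `|im_iter j z| |.
Proof.
move=> j; rewrite im_iterS normrM (gtr0_norm (expR_gt0 _)); congr (_ * _).
by case: (ger0P (im_iter j z)) => // _; rewrite sinN normrN.
Qed.

Lemma orbit_gt0 z : A z -> forall j, 0 < `|im_iter j z|.
Proof.
move=> Az j; have [+ _ _ _] := hA Az Az j.
by rewrite normr_gt0; apply: contraTneq => ->; rewrite mul0r ltxx.
Qed.

(** Iteration of [expC_pair_gain]. *)
Lemma sqdist_gain z w n : A z -> A w ->
  L n z * sqdist 0 z w * (im_iter n z * im_iter n w) <= sqdist n z w * (im_iter 0 z * im_iter 0 w).
Proof.
move=> Az Aw; have P0 m : 0 < im_iter m z * im_iter m w by have [] := hA Az Aw m.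
elim: n => [|n IH]; first by rewrite /L big_ord0 mul1r.
have h := expC_pair_gain (re_iter n z) (re_iter n w) (hA Az Aw n).
rewrite -!im_iterS -!re_iterS -/(sqdist n z w) -/(sqdist n.+1 z w) in h.
have -> : L n.+1 z = L n z * gain `|im_iter n z| by rewrite /L big_ord_recr.
rewrite -(ler_pM2r (P0 n)).
have g0 : 0 <= gain `|im_iter n z| by rewrite (le_trans ler01)// gain_ge1.
apply: (@le_trans _ _ (sqdist n z w * (im_iter 0 z * im_iter 0 w) * (gain `|im_iter n z| * (im_iter n.+1 z * im_iter n.+1 w)))).
  rewrite [leLHS](_ : _ = (L n z * sqdist 0 z w * (im_iter n z * im_iter n w)) *
     (gain `|im_iter n z| * (im_iter n.+1 z * im_iter n.+1 w))); last ring.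
  by rewrite ler_wpM2r// mulr_ge0// ltW.
rewrite [leLHS](_ : _ = (gain `|im_iter n z| * sqdist n z w * (im_iter n.+1 z * im_iter n.+1 w)) *
  (im_iter 0 z * im_iter 0 w)); last ring.
rewrite [leRHS](_ : _ = (sqdist n.+1 z w * (im_iter n z * im_iter n w)) * (im_iter 0 z * im_iter 0 w)); last ring.
by rewrite ler_wpM2r// ltW.
Qed.

(** The form of [gain_growth] used for summation: [theta] is a suitable root of
[2 / 3]. *)
Lemma uniform_gain_growth : exists2 th : R, 0 < th < 1 &
  forall z i, A z -> good 0 z -> good i z -> 1 <= L i z * th ^+ (2 * i).
Proof.
have [e0 _] := gain_excess_bounds R.
have [N hN] : exists N, 500 * (3 / 2) <= (1 + gain_excess R) ^+ N.
  have c0 : 0 <= 500 * (3 / 2) :> R by lra.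
  exact: pow_unbounded.
pose K := (2 * N.+1)%N.
have K0 : (0 : R) < (2 * K)%:R by rewrite ltr0n.
pose th : R := (2 / 3) `^ (2 * K)%:R^-1.
have thK : th ^+ (2 * K) = 2 / 3.
  rewrite -powR_mulrn ?powR_ge0// -powRrM mulVf ?gt_eqF// powRr1//.
have /andP[th0 th1] : 0 < th < 1 by apply: powR_lt1; [lra|rewrite invr_gt0].
exists th; first by rewrite th0.
move=> z i Az [z0 x0] [zi _].
have := @gain_growth R (re_iter ^~ z) (fun j => `|im_iter j z|) (orbit_x z) (orbit_u z) (orbit_gt0 Az) N i hN x0 z0 zi.
rewrite -/K -/(L i z) => hL.
have Lp : 0 <= L i z * th ^+ (2 * i).
  rewrite mulr_ge0 ?exprn_ge0 ?(ltW th0)// /L prodr_ge0// => j _.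
  by rewrite (le_trans ler01)// gain_ge1.
have : 1 <= (L i z * th ^+ (2 * i)) ^+ K.
  rewrite exprMn -exprM [(2 * i * K)%N](_ : _ = (2 * K * i)%N); last by rewrite mulnAC.
  rewrite exprM thK.
  apply: (@le_trans _ _ ((3 / 2) ^+ i * (2 / 3) ^+ i)).
    rewrite -exprMn.
    by have -> : 3 / 2 * (2 / 3) = 1 :> R by [field]; rewrite expr1n.
  by rewrite ler_wpM2r// exprn_ge0//; lra.
by rewrite -[leLHS](expr1n R K) ler_pXn2r ?nnegrE ?muln_gt0.
Qed.

(** Two points whose iterates at time [i + 1] lie in a unit slice at distance about
[2 ^ p]: one step back by [expC_expand], with [|f^(i + 1) z| = expR (re_iter i z)],
then [i] steps back by [sqdist_gain]. *)
Lemma slice_sqdist z w i (p : nat) (th M : R) : A z -> A w ->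
  `|im_iter 0 z| <= M -> `|im_iter 0 w| <= M -> 0 < th ->
  good i z -> good i w -> 1 <= L i z * th ^+ (2 * i) ->
  2 ^+ p <= `|re_iter i.+1 z| + 1 -> 2 ^+ p <= `|re_iter i.+1 w| + 1 ->
  `|re_iter i.+1 z - re_iter i.+1 w| <= 1 ->
  sqdist 0 z w <= (17 * M * (1 + expR 1) * th ^+ i * (1 / 2) ^+ p) ^+ 2.
Proof.
move=> Az Aw Mz Mw th0 [yz xz] [yw xw] Lth pz pw Xzw.
have [P0 _ dY _] := hA Az Aw i.
have [P00 _ _ _] := hA Az Aw 0%N.
have [_ _ dY1 _] := hA Az Aw i.+1.
pose Q : R := 1 + expR 1.
have Q0 : 0 < Q by have := expR_gt0 (1 : R); rewrite /Q; lra.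
(* the next iterate has modulus [expR (re_iter i v)], which is at least [1 / e] *)
have hx v : - 1 <= re_iter i v -> `|re_iter i.+1 v| + 1 <= Q * expR (re_iter i v).
  move=> xv; rewrite /Q mulrDl mul1r lerD//.
    rewrite re_iterS normrM (gtr0_norm (expR_gt0 _)) ler_piMr ?expR_ge0//.
    exact: cos_max.
  by rewrite -expRD -[leLHS]expR0 ler_expR; lra.
(* [1 ^ 2 + pi ^ 2 <= 17] *)
have d1 : sqdist i.+1 z w <= 17.
  have h1 : (re_iter i.+1 z - re_iter i.+1 w) ^+ 2 <= 1.
    by rewrite -real_normK ?num_real// expr_le1.
  have h2 : (im_iter i.+1 z - im_iter i.+1 w) ^+ 2 <= 4 ^+ 2.
    rewrite -real_normK ?num_real// lerXn2r ?nnegrE//.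
    by apply: (le_trans dY1); have := pihalf_lt2 R; lra.
  have e : 4 ^+ 2 = 16 :> R by ring.
  rewrite e in h2; rewrite /sqdist; lra.
have di : expR (re_iter i z + re_iter i w) * sqdist i z w <= 4 * sqdist i.+1 z w.
  exact: expC_expand.
rewrite expRD in di.
have d0 := sqdist_gain i Az Aw.
have dge n : 0 <= sqdist n z w by rewrite addr_ge0 ?sqr_ge0.
have Pi : 1 / 4 <= im_iter i z * im_iter i w.
  rewrite -(gtr0_norm P0) normrM.
  have -> : 1 / 4 = 1 / 2 * (1 / 2) :> R by field.
  by rewrite ler_pM.
have P0M : im_iter 0 z * im_iter 0 w <= M ^+ 2.
  by rewrite -(gtr0_norm P00) normrM expr2 ler_pM.
have L0 : 0 <= L i z.
  by rewrite /L prodr_ge0// => j _; rewrite (le_trans ler01)// gain_ge1.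
have b1 : L i z * sqdist 0 z w <= 4 * (sqdist i z w * M ^+ 2).
  have h1 : L i z * sqdist 0 z w * (1 / 4) <= L i z * sqdist 0 z w * (im_iter i z * im_iter i w).
    by rewrite ler_wpM2l// mulr_ge0.
  have h2 : sqdist i z w * (im_iter 0 z * im_iter 0 w) <= sqdist i z w * M ^+ 2 by rewrite ler_wpM2l.
  lra.
have b2 : 2 ^+ p * 2 ^+ p * sqdist i z w <= Q ^+ 2 * (4 * 17).
  have hz : 2 ^+ p <= Q * expR (re_iter i z) by apply: (le_trans pz); exact: hx.
  have hw : 2 ^+ p <= Q * expR (re_iter i w) by apply: (le_trans pw); exact: hx.
  apply: (@le_trans _ _ (Q * expR (re_iter i z) * (Q * expR (re_iter i w)) * sqdist i z w)).
    by rewrite ler_wpM2r// ler_pM// exprn_ge0.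
  rewrite [leLHS](_ : _ = Q ^+ 2 * (expR (re_iter i z) * expR (re_iter i w) * sqdist i z w)); last ring.
  rewrite ler_wpM2l ?sqr_ge0//; apply: (le_trans di).
  by rewrite ler_wpM2l.
have t0 : 0 <= th ^+ (2 * i) by rewrite exprn_ge0// ltW.
have b3 : sqdist 0 z w <= th ^+ (2 * i) * (4 * (sqdist i z w * M ^+ 2)).
  apply: (@le_trans _ _ (th ^+ (2 * i) * (L i z * sqdist 0 z w))).
    by rewrite mulrA [th ^+ _ * _]mulrC ler_peMl.
  by rewrite ler_wpM2l.
have hp : (1 / 2) ^+ p * 2 ^+ p = 1 :> R.
  by rewrite -exprMn (_ : 1 / 2 * 2 = 1) ?expr1n//; field.
have b4 : sqdist i z w <= ((1 / 2) ^+ p) ^+ 2 * (Q ^+ 2 * (4 * 17)).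
  rewrite [leLHS](_ : _ = ((1 / 2) ^+ p * 2 ^+ p) ^+ 2 * sqdist i z w); last first.
    by rewrite hp expr1n mul1r.
  rewrite [leLHS](_ : _ = ((1 / 2) ^+ p) ^+ 2 * (2 ^+ p * 2 ^+ p * sqdist i z w)); last ring.
  by rewrite ler_wpM2l ?sqr_ge0.
apply: (le_trans b3).
rewrite mulnC exprM.
rewrite [leRHS](_ : _ = (th ^+ i) ^+ 2 * (((1 / 2) ^+ p) ^+ 2 * (Q ^+ 2 * 289) * M ^+ 2)); last first.
  by rewrite -/Q; ring.
rewrite ler_wpM2l ?sqr_ge0// mulrA ler_wpM2r ?sqr_ge0//.
have : 0 <= ((1 / 2) ^+ p) ^+ 2 * Q ^+ 2 by rewrite mulr_ge0 ?sqr_ge0.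
move: b4; move: (((1 / 2) ^+ p) ^+ 2) (Q ^+ 2) => a b; nra.
Qed.

End core.
End two_orbits.

(** * Covering by slices, and pull-backs of null sets *)

Section covering.
Variable R : realType.
Implicit Types (A B : set R[i]) (z w : R[i]).
Local Notation normc := (@Normc.normc R).
Local Notation f := (@expC R).
Local Notation Re := (@complex.Re R).
Local Notation Im := (@complex.Im R).

(** The covering argument: for each good time [i] and each dyadic scale [p] of the
next real part, cut into unit slices and sum. *)
Lemma null_of_good_start A (s : R) : 1 < s ->
  (forall z w, A z -> A w -> forall n, same_half_strip (im_iter n z) (im_iter n w)) ->
  (forall z, A z -> good 0 z) -> null s A.
Proof.
move=> s1 hA gA; have s0 : 0 < s by lra.
have [A0|/set0P[z0 Az0]] := eqVneq A set0.
  by rewrite A0 /null content0.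
have [th /andP[th0 th1] growA] := uniform_gain_growth hA.
pose M := `|im_iter 0 z0| + pi.
have pi0 := @pi_gt0 R.
have MA z : A z -> `|im_iter 0 z| <= M.
  move=> Az; have [_ _ d _] := hA _ _ Az Az0 0%N.
  rewrite -[im_iter 0 z](subrK (im_iter 0 z0)) /M addrC (le_trans (ler_normD _ _))//.
  by rewrite lerD2l.
have M0 : 0 < M by rewrite /M ltr_wpDl.
pose D := 17 * M * (1 + expR 1).
have D0 : 0 < D by rewrite /D !mulr_gt0// addr_gt0// expR_gt0.
pose E i p := [set z | A z /\ good i z /\ 2 ^+ p <= `|re_iter i.+1 z| + 1 < 2 ^+ p.+1].
have cE i p : (content s (E i p) <=
   ((2 ^ p.+2)%:R * (D * th ^+ i * (1 / 2) ^+ p) `^ s)%:E)%E.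
  (* on [E i p] the shifted real part ranges over [0, 2 ^ p.+2] *)
  apply: (@content_slices R s _ (fun z => re_iter i.+1 z + 2 ^+ p.+1)).
  - exact: ltW.
  - by rewrite !mulr_ge0 ?exprn_ge0 ?(ltW D0) ?(ltW th0)//; lra.
  - move=> z [_ [_ /andP[_ hp]]]; rewrite natrX (exprS 2 p.+1).
    have : `|re_iter i.+1 z| < 2 ^+ p.+1 by lra.
    by rewrite ltr_norml => /andP[h1 h2]; lra.
  - move=> z w [Az [gz /andP[pz _]]] [Aw [gw /andP[pw _]]].
    rewrite opprD addrACA subrr addr0 => Xzw.
    apply: normc_le; first by rewrite !mulr_ge0 ?exprn_ge0 ?(ltW D0) ?(ltW th0)//; lra.
    rewrite /D; apply: (slice_sqdist hA) => //; [exact: MA|exact: MA|].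
    exact: growA (gA _ Az) _.
pose r : R := 2 * (1 / 2) `^ s; have r01 := powR_half_lt1 s1; rewrite -/r in r01.
pose tau := th `^ s; have tau01 : 0 < tau < 1 by apply: powR_lt1 => //; rewrite th0.
have cE' i p : (content s (E i p) <= ((4 * D `^ s * tau ^+ i) * r ^+ p)%:E)%E.
  apply: (le_trans (cE i p)); rewrite lee_fin.
  rewrite powRM ?powRM ?powRX ?exprn_ge0 ?mulr_ge0 ?exprn_ge0 ?(ltW D0) ?(ltW th0)//; try lra.
  by rewrite -/tau natrX /r exprMn !exprS; lra.
pose Ei i := [set z | A z /\ good i z].
have EiE i : Ei i `<=` \bigcup_p E i p.
  move=> z [Az gz]; pose a := `|re_iter i.+1 z| + 1.
  have a1 : 1 <= a by rewrite /a lerDr.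
  pose p := trunc_log 2 (Num.truncn a).
  have a0 : 0 <= a by lra.
  have t0 : (0 < Num.truncn a)%N by rewrite truncn_gt0.
  have /andP[h1 h2] := trunc_log_bounds (erefl : (1 < 2)%N) t0.
  have /andP[h3 h4] := truncn_itv a0.
  exists p => //; split => //; split => //; rewrite -/a; apply/andP; split.
    by apply: le_trans h3; rewrite -natrX ler_nat.
  by apply: (lt_le_trans h4); rewrite -natrX ler_nat.
have cEi i : (content s (Ei i) <= (4 * D `^ s * tau ^+ i / (1 - r))%:E)%E.
  apply: (le_trans (content_mono s (EiE i))).
  apply: (le_trans (content_bigcup _ _)).
  apply: (@le_trans _ _ (\sum_(p <oo) ((4 * D `^ s * tau ^+ i) * r ^+ p)%:E)%E).
    by apply: lee_nneseries => // *; exact: content_ge0.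
  apply: geometric_series_le => //.
  by rewrite !mulr_ge0 ?powR_ge0 ?exprn_ge0//; case/andP: tau01 => /ltW.
have /andP[tau0 tau1] := tau01; have /andP[r0 r1] := r01.
pose b := 4 * D `^ s / (1 - r).
have b0 : 0 <= b by rewrite /b mulr_ge0 ?mulr_ge0 ?powR_ge0 ?invr_ge0//; lra.
have cA N : (content s A <= ((b / (1 - tau)) * tau ^+ N)%:E)%E.
  apply: (@le_trans _ _ (content s (\bigcup_j Ei (N + j)%N))).
    apply: content_mono => z Az.
    have [i Ni [gy gx]] := good_infinitely_often (orbit_x z) (orbit_u z) (orbit_gt0 hA Az) N.
    by exists (i - N)%N => //=; rewrite subnKC.
  apply: (le_trans (content_bigcup _ _)).
  apply: (@le_trans _ _ (\sum_(j <oo) ((b * tau ^+ N) * tau ^+ j)%:E)%E).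
    apply: lee_nneseries => [*|j _]; first exact: content_ge0.
    apply: (le_trans (cEi _)); rewrite lee_fin /b exprD.
    have -> : 4 * D `^ s * (tau ^+ N * tau ^+ j) / (1 - r) =
      4 * D `^ s / (1 - r) * tau ^+ N * tau ^+ j by field; lra.
    exact: lexx.
  apply: (le_trans (geometric_series_le _ tau01)).
    by rewrite mulr_ge0// exprn_ge0// ltW.
  by rewrite lee_fin -mulrA [_ ^+ N / _]mulrC mulrA.
apply: null_small => e e0.
have [N hN] : exists N, b / (1 - tau) / e <= (1 + (tau^-1 - 1)) ^+ N.
  apply: pow_unbounded; first by rewrite divr_ge0 ?(ltW e0)// divr_ge0// subr_ge0 ltW.
  by rewrite subr_gt0 invf_gt1.
apply: (le_trans (cA N)); rewrite lee_fin.
by move: hN; rewrite subrKC exprVn ler_pdivrMr// [leRHS]mulrC ler_pdivlMr ?exprn_gt0.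
Qed.

(** By [expC_expand] the inverse of [exp] is Lipschitz on the image of each piece
[Re z >= - k]. *)
Lemma null_expC A (s : R) : 0 < s -> (forall z w, A z -> A w -> `|Im z - Im w| <= pi) ->
  null s (f @` A) -> null s A.
Proof.
move=> s0 hA nf.
apply: (@null_sub _ _ _ (\bigcup_k [set z | A z /\ - k%:R <= Re z])).
  move=> z Az; exists (Num.bound `|Re z|) => //; split => //.
  by have := archi_boundP (normr_ge0 (Re z)); rewrite ltr_norml => /andP[/ltW].
apply: null_bigcup => k.
apply: (@null_lipschitz _ _ _ f (2 * expR k%:R)) => //.
- move=> z w [Az zk] [Aw wk]; have hzw := hA _ _ Az Aw.
  have C0 : 0 <= 2 * expR k%:R * normc (f z - f w) by rewrite !mulr_ge0 ?expR_ge0 ?normc_nonneg.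
  apply: normc_le => //; rewrite exprMn normc_sqr.
  have h : expR (Re z + Re w) * sqdist 0 z w <= 4 * sqdist 0 (f z) (f w).
    exact: expC_expand.
  have ek : 1 <= expR k%:R * expR k%:R * expR (Re z + Re w).
    by rewrite -!expRD -[leLHS]expR0 ler_expR; lra.
  have d0 : 0 <= sqdist 0 z w by rewrite addr_ge0 ?sqr_ge0.
  apply: (@le_trans _ _ (expR k%:R * expR k%:R * (expR (Re z + Re w) * sqdist 0 z w))).
    by rewrite mulrA ler_peMl.
  rewrite [leRHS](_ : _ = expR k%:R * expR k%:R * (4 * sqdist 0 (f z) (f w))); last ring.
  by rewrite ler_wpM2l// mulr_ge0 ?expR_ge0.
- by apply: null_sub nf => _ [z [Az _] <-]; exists z.
Qed.

(** A strip has height [2 pi]; its two halves satisfy the hypothesis of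
[null_expC]. *)
Lemma null_expC_strip A (s : R) (c : int) : 0 < s -> A `<=` strip c ->
  null s (f @` A) -> null s A.
Proof.
move=> s0 hA nf.
apply: (@null_sub _ _ _ ((A `&` [set z | Im z <= 2 * c%:~R * pi]) `|`
   (A `&` [set z | 2 * c%:~R * pi <= Im z]))).
  by move=> z Az; have [h|/ltW h] := leP (Im z) (2 * c%:~R * pi); [left|right].
apply: null_setU; (apply: null_expC => //; last
  by apply: null_sub nf => _ [z [Az _] <-]; exists z).
- move=> z w [/hA /andP[z1 z2] z3] [/hA /andP[w1 w2] w3].
  by rewrite /= in z3 w3; rewrite ler_norml; lra.
- move=> z w [/hA /andP[z1 z2] z3] [/hA /andP[w1 w2] w3].
  by rewrite /= in z3 w3; rewrite ler_norml; lra.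
Qed.

Lemma null_iter A (s : R) c n : 0 < s -> A `<=` itinerary_set f c ->
  null s (iter n f @` A) -> null s A.
Proof.
move=> s0 hA; elim: n => [|n IH] h.
  by apply: null_sub h => z Az; exists z.
apply: IH; apply: (@null_expC_strip _ _ (c n)) => //.
  by move=> _ [z Az <-]; exact: hA.
by apply: null_sub h => _ [_ [z Az <-] <-]; exists z.
Qed.

(** Every point has a good time; start the orbits there and pull back. *)
Lemma null_same_half_strip A (s : R) c : 1 < s -> A `<=` itinerary_set f c ->
  (forall z w, A z -> A w -> forall n, same_half_strip (im_iter n z) (im_iter n w)) -> null s A.
Proof.
move=> s1 Ac hA.
apply: (@null_sub _ _ _ (\bigcup_i [set z | A z /\ good i z])).
  move=> z Az.
  have [i _ [gy gx]] := good_infinitely_often (orbit_x z) (orbit_u z) (orbit_gt0 hA Az) 0.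
  by exists i.
apply: null_bigcup => i; apply: (@null_iter _ _ c i); first lra.
  by move=> z [/Ac].
have sh n z : iter n f (iter i f z) = iter (n + i) f z by rewrite iterD.
apply: null_of_good_start => // [_ _ [z [Az gz] <-] [w [Aw gw] <-] n|_ [z [Az gz] <-]].
  by rewrite /im_iter !sh; exact: hA.
exact: gz.
Qed.

Lemma null_real_axis (s : R) : 1 < s -> null s [set z | Im z = 0].
Proof.
move=> s1; have s0 : 0 < s by lra.
apply: (@null_sub _ _ _ (\bigcup_k [set z | Im z = 0 /\ - k%:R <= Re z < k%:R])).
  move=> z z0; exists (Num.bound `|Re z|) => //; split => //.
  have := archi_boundP (normr_ge0 (Re z)); rewrite ltr_norml => /andP[h1 h2].
  by rewrite (ltW h1).
apply: null_bigcup => k; apply: null_small => e e0.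
pose r : R := 2 * (1 / 2) `^ s; have := powR_half_lt1 s1; rewrite -/r => /andP[r0 r1].
have [N hN] : exists N, (2 * k)%:R / e <= (1 + (r^-1 - 1)) ^+ N.
  apply: pow_unbounded; first by rewrite divr_ge0// ltW.
  by rewrite subr_gt0 invf_gt1.
apply: (@le_trans _ _ ((2 * k * 2 ^ N)%:R * ((1 / 2) ^+ N) `^ s)%:E).
  have hp : (1 / 2) ^+ N * 2 ^+ N = 1 :> R.
    by rewrite -exprMn (_ : 1 / 2 * 2 = 1) ?expr1n//; field.
  have p0 : 0 < 2 ^+ N :> R by rewrite exprn_gt0.
  have q0 : 0 <= (1 / 2) ^+ N :> R by rewrite exprn_ge0//; lra.
  apply: (@content_slices R s _ (fun z => (Re z + k%:R) * 2 ^+ N)).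
  - exact: ltW.
  - exact: q0.
  - move=> z [_ /andP[h1 h2]]; rewrite natrM natrX natrM ltr_pM2r//.
    by rewrite mulr_ge0 ?(ltW p0)//=; lra.
  - move=> z w [z0 _] [w0 _]; rewrite -mulrBl opprD addrACA subrr addr0 => h.
    apply: normc_le => //; rewrite /sqdist /re_iter /im_iter /= z0 w0 subrr expr0n/= addr0.
    rewrite -[leLHS]real_normK ?num_real// lerXn2r ?nnegrE//.
    rewrite normrM (gtr0_norm p0) in h.
    have -> : `|Re z - Re w| = (1 / 2) ^+ N * (`|Re z - Re w| * 2 ^+ N).
      by rewrite mulrCA hp mulr1.
    by rewrite -[leRHS]mulr1 ler_wpM2l.
rewrite lee_fin powRX ?(natrM _ (2 * k)) ?natrX; last lra.
rewrite -mulrA -exprMn -/r.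
by move: hN; rewrite subrKC exprVn ler_pdivrMr// [leRHS]mulrC ler_pdivlMr ?exprn_gt0.
Qed.

End covering.

(** * Splitting the itinerary set by signs *)

Section signs.
Variable R : realType.
Implicit Types (A B : set R[i]) (z w : R[i]).
Local Notation f := (@expC R).
Local Notation Re := (@complex.Re R).
Local Notation Im := (@complex.Im R).

Lemma sin_shift (c : int) (y : R) : sin (y - 2 * c%:~R * pi) = sin y.
Proof.
have h n : sin (y + n%:R * (pi *+ 2)) = sin y.
  by rewrite mulr_natl; exact: (periodicn (@sinD2pi R)).
have h' n : sin (y - n%:R * (pi *+ 2)) = sin y.
  rewrite mulr_natl; have := periodicn (@sinD2pi R) n (y - pi *+ 2 *+ n).
  by rewrite subrK => <-.
case: c => n.
  by rewrite -[RHS](h' n) -pmulrn; congr (sin (_ - _)); rewrite mulr2n; ring.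
rewrite NegzE mulrNz -[RHS](h n.+1) -pmulrn; congr (sin _).
by rewrite (mulr2n pi); ring.
Qed.

Lemma sin_pos_itv (t : R) : - pi < t <= pi -> 0 < sin t -> 0 < t < pi.
Proof.
move=> /andP[t1 t2] s0; apply/andP; split.
  rewrite ltNge; apply/negP => t0.
  have : 0 <= sin (- t) by rewrite sin_ge0_pi// oppr_ge0 t0/= lerNl ltW.
  by rewrite sinN; lra.
by rewrite lt_neqAle t2 andbT; apply: contraTneq s0 => ->; rewrite sinpi ltxx.
Qed.

Lemma sin_neg_itv (t : R) : - pi < t <= pi -> sin t < 0 -> - pi < t < 0.
Proof.
move=> /andP[t1 t2] s0; rewrite t1 /= ltNge; apply/negP => t0.
have : 0 <= sin t by rewrite sin_ge0_pi// t0.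
lra.
Qed.

Section itinerary.
Variable c : nat -> int.
Let Lam := itinerary_set f c.

Lemma strip_shift n z : Lam z ->
  - pi < im_iter n z - 2 * (c n)%:~R * pi <= pi.
Proof. by move=> /(_ n); rewrite /strip/= -/(im_iter n z) => /andP[h1 h2]; apply/andP; split; lra. Qed.

Lemma int_trichotomy (k : int) : [\/ k = 0, 1 <= (k%:~R : R) | (k%:~R : R) <= -1].
Proof.
have [k0|k0|->] := ltgtP k 0; last by constructor 1.
- constructor 3; rewrite -(mulrNz 1 1) ler_int; lia.
- constructor 2; rewrite -[1](mulr1z) ler_int; lia.
Qed.

(** In a given strip, the sign of the next imaginary part tells the half-strip. *)
Lemma same_sign_same_half_strip z w : Lam z -> Lam w ->
  (forall n, 0 < im_iter n z * im_iter n w) -> forall n, same_half_strip (im_iter n z) (im_iter n w).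
Proof.
move=> Lz Lw zw n.
have hz := strip_shift n Lz; have hw := strip_shift n Lw.
have pi0 := @pi_gt0 R.
have s0 : 0 < sin (im_iter n z) * sin (im_iter n w).
  have := zw n.+1; rewrite !im_iterS mulrACA pmulr_rgt0// mulr_gt0// expR_gt0 //.
have dY : `|im_iter n z - im_iter n w| <= pi.
  have e : im_iter n z - im_iter n w = (im_iter n z - 2 * (c n)%:~R * pi) - (im_iter n w - 2 * (c n)%:~R * pi) by ring.
  move: s0; rewrite e -(sin_shift (c n) (im_iter n z)) -(sin_shift (c n) (im_iter n w)).
  move: hz hw; move: (_ - _) (im_iter n w - _) => t u ht hu.
  have [t0|t0|t0] := ltgtP (sin t) 0.
  - rewrite nmulr_rgt0// => u0.
    have := sin_neg_itv ht t0; have := sin_neg_itv hu u0.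
    by rewrite ler_norml; lra.
  - rewrite pmulr_rgt0// => u0.
    have := sin_pos_itv ht t0; have := sin_pos_itv hu u0.
    by rewrite ler_norml; lra.
  - by rewrite t0 mul0r ltxx.
split => //.
move: hz hw; have [->|k1|k1] := int_trichotomy (c n).
- rewrite mulr0z mulr0 mul0r !subr0 => /andP[h1 h2] /andP[h3 h4].
  by left; rewrite !ler_norml h2 h4 !ltW.
- move=> /andP[h1 _] /andP[h3 _]; right.
  have : (pi : R) <= (c n)%:~R * pi by rewrite ler_peMl// ltW.
  by split; apply: le_trans (ler_norm _); lra.
- move=> /andP[_ h1] /andP[_ h3]; right.
  have : (c n)%:~R * pi <= -1 * pi :> R by rewrite ler_wpM2r// ltW.
  by split; rewrite -normrN; apply: le_trans (ler_norm _); lra.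
Qed.

(** Only the strip with symbol 0 meets both half-planes, and there [sin y] has the
sign of [y]. *)
Lemma opposite_persist n z w : Lam z -> Lam w -> im_iter n.+1 z != 0 -> im_iter n.+1 w != 0 ->
  0 < im_iter n z -> im_iter n w < 0 -> 0 < im_iter n.+1 z /\ im_iter n.+1 w < 0.
Proof.
move=> Lz Lw z1 w1 z0 w0.
have := strip_shift n Lz; have := strip_shift n Lw.
have pi0 := @pi_gt0 R.
have [->|k1|k1] := int_trichotomy (c n); first last.
- have : (c n)%:~R * pi <= -1 * pi :> R by rewrite ler_wpM2r// ltW.
  by move=> ? /andP[_ _] /andP[_ ?]; lra.
- have : (pi : R) <= (c n)%:~R * pi by rewrite ler_peMl// ltW.
  by move=> ? /andP[? _]; lra.
rewrite mulr0z mulr0 mul0r !subr0 => /andP[h1 _] /andP[_ h4].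
rewrite lt_neqAle eq_sym z1 [_ < 0]lt_neqAle w1 /= !im_iterS.
rewrite mulr_ge0 ?expR_ge0 ?sin_ge0_pi ?h4 ?(ltW z0)//; split => //.
rewrite -oppr_ge0 -mulrN -sinN mulr_ge0 ?expR_ge0// sin_ge0_pi//.
by rewrite oppr_ge0 (ltW w0)/= lerNl ltW.
Qed.

Definition nonreal := [set z | Lam z /\ forall n, im_iter n z != 0].

(** Two points of the same side never have opposite signs: the signs would be
constant afterwards, and one of them would visit the side [b] finitely often. *)
Definition recurrent_side (b : bool) :=
  [set z | nonreal z /\ forall N, exists2 m, (N <= m)%N & (0 < im_iter m z) = b].

Lemma opposite_forever n z w : nonreal z -> nonreal w -> 0 < im_iter n z -> im_iter n w < 0 ->
  forall m, (n <= m)%N -> 0 < im_iter m z /\ im_iter m w < 0.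
Proof.
move=> [Lz nz] [Lw nw] z0 w0 m /subnK <-.
elim: (m - n)%N => [//|k [h1 h2]]; rewrite addSn.
exact: opposite_persist.
Qed.

Lemma recurrent_side_same b z w : recurrent_side b z -> recurrent_side b w ->
  forall n, 0 < im_iter n z * im_iter n w.
Proof.
have main z' w' n : recurrent_side b z' -> recurrent_side b w' ->
    0 < im_iter n z' -> im_iter n w' < 0 -> False.
  move=> [nz bz] [nw bw] z0 w0.
  have [m nm bE] := bz n; have [k nk bE'] := bw n.
  have [hz _] := opposite_forever nz nw z0 w0 nm.
  have [_ hw] := opposite_forever nz nw z0 w0 nk.
  by move: bE'; rewrite -bE hz; lra.
move=> bz bw n.
have z0 : im_iter n z != 0 by case: bz => -[].
have w0 : im_iter n w != 0 by case: bw => -[].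
case: (ltgtP (im_iter n z) 0) z0 => // hz _; case: (ltgtP (im_iter n w) 0) w0 => // hw _.
- by rewrite nmulr_rgt0.
- by case: (main w z n).
- by case: (main z w n).
- by rewrite pmulr_rgt0.
Qed.

Lemma recurrent_side_cover : nonreal `<=` recurrent_side true `|` recurrent_side false.
Proof.
move=> z nz; have [h|h] := pselect (forall N, exists2 m, (N <= m)%N & 0 < im_iter m z).
  by left; split => // N; have [m] := h N; exists m.
right; split => // N; apply: contrapT => hN; apply: h => M.
exists (maxn N M); first exact: leq_maxr.
apply: contrapT => /negP /negbTE hh; apply: hN; exists (maxn N M) => //.
exact: leq_maxl.
Qed.

Lemma itinerary_null (s : R) : 1 < s -> null s Lam.
Proof.
move=> s1; have s0 : 0 < s by lra.
have side b : null s (recurrent_side b).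
  apply: (null_same_half_strip s1 (c := c)); first by move=> z [[]].
  move=> z w bz bw; apply: same_sign_same_half_strip; [by case: bz => -[]|by case: bw => -[]|].
  exact: (recurrent_side_same bz bw).
apply: (@null_sub _ _ _ ((\bigcup_n (Lam `&` [set z | im_iter n z = 0])) `|`
   (recurrent_side true `|` recurrent_side false))).
  move=> z Lz; have [h|h] := pselect (exists n, im_iter n z = 0).
    by left; case: h => n zn; exists n.
  right; apply: recurrent_side_cover; split => // n.
  by apply/eqP => zn; apply: h; exists n.
apply: null_setU; last exact: null_setU.
apply: null_bigcup => n; apply: (@null_iter _ _ s c n) => //.
by apply: null_sub (null_real_axis s1) => _ [z [_ zn] <-].
Qed.

End itinerary.
End signs.

Theorem theorem1 (R : realType) (c : nat -> int) :
  (hausdorff_dim (itinerary_set (@expC R) c) <= 1)%E.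
Proof. by apply: hausdorff_dim_le1 => s; exact: itinerary_null. Qed.
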